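(* Let $X$ be a connected, finite CW-complex with $H_1(X;\mathbb{Z})\cong\mathbb{Z}^n$, let $k\ge 0$ be an integer, and let $V_k(X)\subseteq(\mathbb{C}^* )^n$ be its $k$-th characteristic variety. The following are isomorphism type invariants of $\pi_1(X)$ (that is, they coincide for any two such complexes with isomorphic fundamental groups): (a) the list $\Sigma_k(X)$ of codimensions of irreducible components of $V_k(X)$; (b) the list $\Sigma_{\mathbf{1},k}(X)$ of codimensions of irreducible components of $V_k(X)$ passing through $\mathbf{1}=(1,\dots,1)$; (c) for each integer $p\ge 2$, the number $\operatorname{Tors}_{p,k}(X)=|\Omega_p^n\cap V_k(X)|$ of $p$-torsion points of $V_k(X)$.
   Context: Let $X$ be a connected finite CW-complex with basepoint $*$ and $H_1(X;\mathbb{Z})\cong\mathbb{Z}^n$, and let $\psi:H_1(X)\to\mathbb{Z}^n$ be an isomorphism, which identifies $\mathbb{Z}[H_1(X)]$ with $\Lambda=\mathbb{Z}[t_1^{\pm1},\dots,t_n^{\pm1}]$. Let $p:\widetilde{X}\to X$ be the universal abelian cover. The Alexander module $A(X,\psi)$ is $H_1(\widetilde{X},p^{-1}( * );\mathbb{Z})$ regarded as a $\Lambda$-module. A presentation $\pi_1(X)=\langle x_1,\dots,x_q\mid r_1,\dots,r_s\rangle$ gives a presentation $\Lambda^s\xrightarrow{M}\Lambda^q\to A(X,\psi)\to 0$, where $M=(\partial r_i/\partial x_j)^{\mathrm{ab}}$ is the abelianized Jacobian matrix of Fox derivatives. The $k$-th determinantal ideal $E_k(X,\psi)\subseteq\Lambda$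 is generated by the codimension $k$ minors (the minors of size $q-k$) of $M$. The $k$-th characteristic variety is $$V_k(X)=V_k(X,\psi)=\{t\in(\mathbb{C}^* )^n\mid g(t)=0\text{ for all }g\in\sqrt{E_k(X,\psi)\otimes\mathbb{C}}\}.$$ It is independent of $\psi$ up to automorphisms of $(\mathbb{C}^* )^n$ of the form $t_i\mapsto t_1^{a_{i1}}\cdots t_n^{a_{in}}$ with $(a_{ij})\in\mathrm{GL}_n(\mathbb{Z})$. ''List'' means list with repetitions (multiset). $\Omega_p^n=\{(\omega_1,\dots,\omega_n)\in(\mathbb{C}^* )^n\mid\omega_i^p=1\text{ for all }i\}$. *)

(* Defs.v *)
From HB Require Import structures.
From mathcomp Require Import all_boot all_order all_algebra finmap.
From mathcomp Require Import generic_quotient ring_quotient complex monalg.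
From mathcomp Require Import all_classical all_reals all_analysis.
From mathcomp Require Import lra.

Set Implicit Arguments.
Unset Strict Implicit.
Unset Printing Implicit Defensive.
Import Order.TTheory GRing.Theory Num.Theory.
Import numFieldNormedType.Exports.

Local Open Scope classical_set_scope.
Local Open Scope ring_scope.
Local Open Scope quotient_scope.

Section FundamentalGroup.
Variables (R : realType) (X : topologicalType).

Let I : set R := `[0, 1]%classic.

Let IE (s : R) : I s = (0 <= s <= 1) :> Prop.
Proof. by rewrite /I /= in_itv. Qed.

Let cI : closed I. Proof. exact: itv_closed. Qed.

Lemma within_comp (T U V : topologicalType) (A : set T) (B : set U)
    (f : T -> U) (g : U -> V) :
  {within A, continuous f} -> {within B, continuous g} ->
  (forall x, A x -> B (f x)) -> {within A, continuous (g \o f)}.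
Proof.
move=> /subspace_continuousP cf /subspace_continuousP cg fAB.
apply/subspace_continuousP => x Ax.
apply: (@cvg_comp _ _ _ f g _ (within B (nbhs (f x)))); last exact/cg/fAB.
move=> W /= fW; have /= := cf x Ax _ fW.
rewrite !nbhs_simpl /= /within /=.
by apply: filterS => y + Ay; move=> /(_ Ay); apply; apply: fAB.
Qed.

Lemma within_glue (T V : topologicalType) (A : set T) (u : T -> R)
    (f g : T -> V) : closed A -> continuous u ->
  {within A `&` [set x | u x <= 2^-1], continuous f} ->
  {within A `&` [set x | 2^-1 <= u x], continuous g} ->
  (forall x, A x -> u x = 2^-1 -> f x = g x) ->
  {within A, continuous (fun x => if u x <= 2^-1 then f x else g x)}.
Proof.
move=> cA cu cf cg fg.
rewrite (_ : A = (A `&` [set x | u x <= 2^-1]) `|` (A `&` [set x | 2^-1 <= u x])).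
  apply: withinU_continuous.
  - apply: closedI => //.
    rewrite (_ : [set x | _] = u @^-1` [set x | x <= 2^-1]) //.
    by apply: preimage_closed => //; apply: closed_le.
  - apply: closedI => //.
    rewrite (_ : [set x | _] = u @^-1` [set x | 2^-1 <= x]) //.
    by apply: preimage_closed => //; apply: closed_ge.
  - apply: subspace_eq_continuous cf => x; rewrite inE => -[_ /= ux].
    by rewrite /from_subspace ux.
  - apply: subspace_eq_continuous cg => x; rewrite inE => -[Ax /= ux].
    rewrite /from_subspace; case: ifPn => // ux'; apply/esym/fg => //.
    by apply/eqP; rewrite eq_le ux ux'.
rewrite -setIUr (_ : _ `|` _ = setT) ?setIT //.
by apply/seteqP; split => x //= _; case: (lerP (u x) 2^-1) => [|/ltW]; [left|right].
Qed.

Section Based.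
Variable x0 : X.

Record loop := Loop {
  loop_fun :> R -> X;
  loop_cts : {within I, continuous loop_fun};
  loop_0 : loop_fun 0 = x0;
  loop_1 : loop_fun 1 = x0 }.

HB.instance Definition _ := gen_eqMixin loop.
HB.instance Definition _ := gen_choiceMixin loop.

(* homotopy relative to the endpoints *)
Definition homotopic (f g : loop) : Prop := exists H : R * R -> X,
  [/\ {within I `*` I, continuous H},
      forall s, I s -> H (s, 0) = f s /\ H (s, 1) = g s
    & forall t, I t -> H (0, t) = x0 /\ H (1, t) = x0].

Let I0 : I 0. Proof. by rewrite IE; lra. Qed.
Let I1 : I 1. Proof. by rewrite IE; lra. Qed.
Let I_comp x : I x -> I (1 - x). Proof. by rewrite !IE => ?; lra. Qed.
Let I_dbl x : I x -> x <= 2^-1 -> I (2 * x).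
Proof. by rewrite !IE => ? ?; lra. Qed.
Let I_dbl' x : I x -> 2^-1 <= x -> I (2 * x - 1).
Proof. by rewrite !IE => ? ?; lra. Qed.

Let cfst : continuous (fst : R * R -> R). Proof. by move=> z; exact: cvg_fst. Qed.
Let csnd : continuous (snd : R * R -> R). Proof. by move=> z; exact: cvg_snd. Qed.

Let closedII : closed (I `*` I).
Proof.
rewrite (_ : I `*` I = (fst @^-1` I) `&` (snd @^-1` I)) //.
by apply: closedI; apply: preimage_closed.
Qed.

Let cpair (T : topologicalType) (f g : T -> R) : continuous f ->
  continuous g -> continuous (fun z => (f z, g z)).
Proof. by move=> cf cg z; exact: (cvg_pair (cf z) (cg z)). Qed.

Let c_id : continuous (@id R). Proof. by move=> z; exact: cvg_id. Qed.

Lemma homotopic_reparam (h : R -> X) (p q : R -> R) (f g : loop) :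
  {within I, continuous h} -> continuous p -> continuous q ->
  (forall s, I s -> I (p s)) -> (forall s, I s -> I (q s)) ->
  (forall s, I s -> f s = h (p s)) -> (forall s, I s -> g s = h (q s)) ->
  p 0 = q 0 -> p 1 = q 1 -> homotopic f g.
Proof.
move=> ch cp cq Ip Iq fE gE pq0 pq1.
exists (fun z => h ((1 - z.2) * p z.1 + z.2 * q z.1)); split.
- apply: (@within_comp _ _ _ _ I (fun z : R * R => (1 - z.2) * p z.1 + z.2 * q z.1)) => //.
    apply: continuous_subspaceT => z.
    have c1 : {for z, continuous (fst : R * R -> R)} by apply: cvg_fst.
    have c2 : {for z, continuous (snd : R * R -> R)} by apply: cvg_snd.
    apply: cvgD; apply: cvgM => //.
    + by apply: cvgB => //; apply: cvg_cst.
    + by apply: continuous_comp => //; apply: cp.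
    + by apply: continuous_comp => //; apply: cq.
  move=> [s t] /= [Is It]; have := Ip _ Is; have := Iq _ Is.
  by move: It; rewrite !IE => /andP[? ?] /andP[? ?] /andP[? ?]; apply/andP; split; nra.
- move=> s Is /=; rewrite fE // gE //.
  by rewrite subr0 mul1r mul0r addr0 subrr mul0r mul1r add0r.
- move=> t It /=.
  have E a : (1 - t) * a + t * a = a by lra.
  by rewrite pq0 pq1 !E -!gE // loop_0 loop_1.
Qed.

Lemma homotopic_refl f : homotopic f f.
Proof.
apply: (@homotopic_reparam f id id) => //; try exact: c_id; exact: loop_cts.
Qed.

Lemma homotopic_sym f g : homotopic f g -> homotopic g f.
Proof.
move=> [H [cH H01 Hx]]; exists (fun z => H (z.1, 1 - z.2)); split.
- apply: (@within_comp _ _ _ _ (I `*` I) (fun z : R * R => (z.1, 1 - z.2))) => //.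
    apply: continuous_subspaceT; apply: cpair; first exact: cfst.
    by move=> z; apply: cvgB; [exact: cvg_cst|exact: csnd].
  by move=> z [/= ? ?]; split=> //=; apply: I_comp.
- by move=> s Is /=; rewrite subr0 subrr; have [] := H01 _ Is.
- by move=> t It /=; apply/Hx/I_comp.
Qed.

Lemma homotopic_trans g f h : homotopic f g -> homotopic g h -> homotopic f h.
Proof.
move=> [H [cH H01 Hx]] [K [cK K01 Kx]].
exists (fun z => if z.2 <= 2^-1 then H (z.1, 2 * z.2) else K (z.1, 2 * z.2 - 1)).
have c2 : continuous (fun z : R * R => 2 * z.2).
  by move=> z; apply: cvgM; [exact: cvg_cst|exact: csnd].
split.
- apply: (within_glue closedII).
  + by move=> z; exact: csnd.
  + apply: (@within_comp _ _ _ _ (I `*` I) (fun z : R * R => (z.1, 2 * z.2))) => //.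
      apply: continuous_subspaceT; apply: cpair; first exact: cfst.
      exact: c2.
    by move=> z [[/= ? ?] ?]; split=> //=; apply: I_dbl.
  + apply: (@within_comp _ _ _ _ (I `*` I) (fun z : R * R => (z.1, 2 * z.2 - 1))) => //.
      apply: continuous_subspaceT; apply: cpair; first exact: cfst.
      by move=> z; apply: cvgB; [exact: c2|exact: cvg_cst].
    by move=> z [[/= ? ?] ?]; split=> //=; apply: I_dbl'.
  + move=> [s t] [/= Is It] ->; rewrite divff // subrr.
    by have [_ ->] := H01 _ Is; have [-> _] := K01 _ Is.
- move=> s Is /=; rewrite invr_ge0 ler0n mulr0 ifF; last by apply/negbTE; lra.
  have -> : 2 * 1 - 1 = 1 :> R by lra.
  by split; [apply: (H01 _ Is).1|apply: (K01 _ Is).2].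
- move=> t It /=; case: ifPn => ht; first exact/Hx/I_dbl.
  by apply/Kx/I_dbl' => //; lra.
Qed.

Lemma homotopic_equiv : equiv_class_of (fun f g : loop => `[< homotopic f g >]).
Proof.
split=> [f|f g|g f h]; first exact/asboolP/homotopic_refl.
  by apply/asboolP/asboolP; apply: homotopic_sym.
move=> /asboolP fg /asboolP gh; apply/asboolP; exact: homotopic_trans gh.
Qed.

Canonical loop_equiv := EquivRelPack homotopic_equiv.
Canonical loop_encModRel := defaultEncModRel loop_equiv.

Definition pi1 := {eq_quot loop_equiv}.
HB.instance Definition _ := Choice.on pi1.
HB.instance Definition _ := EqQuotient.on pi1.

Lemma pi1P (f g : loop) : reflect (homotopic f g) (f == g %[mod pi1]).
Proof. by rewrite piE; exact: asboolP. Qed.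

Lemma pi1_eq (f g : loop) : homotopic f g -> \pi_pi1 f = \pi_pi1 g.
Proof. by move=> fg; apply/eqP/pi1P. Qed.

Lemma repr_homotopic (f : loop) : homotopic (repr (\pi_pi1 f)) f.
Proof. by apply/pi1P; rewrite reprK. Qed.

Definition loop_cst : loop :=
  @Loop (cst x0) (continuous_subspaceT (@cst_continuous _ _ x0)) erefl erefl.

Definition cat_fun (f g : R -> X) (s : R) : X :=
  if s <= 2^-1 then f (2 * s) else g (2 * s - 1).

Let cmul2 : continuous (fun s : R => 2 * s).
Proof. by move=> z; apply: cvgM; [exact: cvg_cst|exact: cvg_id]. Qed.

Let cmul2B : continuous (fun s : R => 2 * s - 1).
Proof. by move=> z; apply: cvgB; [exact: cmul2|exact: cvg_cst]. Qed.

Let cBl : continuous (fun s : R => 1 - s).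
Proof. by move=> z; apply: cvgB; [exact: cvg_cst|exact: cvg_id]. Qed.

Lemma cat_cts (f g : loop) : {within I, continuous (cat_fun f g)}.
Proof.
apply: (@within_glue _ _ _ id) => //.
- apply: (@within_comp _ _ _ _ I (fun s : R => 2 * s)).
  + exact: continuous_subspaceT.
  + exact: loop_cts.
  + by move=> s [? ?]; apply: I_dbl.
- apply: (@within_comp _ _ _ _ I (fun s : R => 2 * s - 1)).
  + exact: continuous_subspaceT.
  + exact: loop_cts.
  + by move=> s [? ?]; apply: I_dbl'.
- by move=> s _ ->; rewrite divff // subrr loop_0 loop_1.
Qed.

Lemma cat_0 (f g : loop) : cat_fun f g 0 = x0.
Proof. by rewrite /cat_fun invr_ge0 ler0n mulr0 loop_0. Qed.

Lemma cat_1 (f g : loop) : cat_fun f g 1 = x0.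
Proof.
rewrite /cat_fun ifF; last by apply/negbTE; lra.
by rewrite (_ : 2 * 1 - 1 = 1) ?loop_1 //; lra.
Qed.

Definition loop_cat f g := Loop (@cat_cts f g) (cat_0 f g) (cat_1 f g).

Lemma rev_cts (f : loop) : {within I, continuous (f \o (fun s => 1 - s))}.
Proof.
apply: (@within_comp _ _ _ _ I); first exact: continuous_subspaceT.
  exact: loop_cts.
by move=> s; apply: I_comp.
Qed.

Lemma rev_0 (f : loop) : (f \o (fun s => 1 - s)) 0 = x0.
Proof. by rewrite /= subr0 loop_1. Qed.

Lemma rev_1 (f : loop) : (f \o (fun s => 1 - s)) 1 = x0.
Proof. by rewrite /= subrr loop_0. Qed.

Definition loop_rev f := Loop (@rev_cts f) (rev_0 f) (rev_1 f).

Lemma homotopic_cat f f' g g' : homotopic f f' -> homotopic g g' ->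
  homotopic (loop_cat f g) (loop_cat f' g').
Proof.
move=> [H [cH H01 Hx]] [K [cK K01 Kx]].
exists (fun z => if z.1 <= 2^-1 then H (2 * z.1, z.2) else K (2 * z.1 - 1, z.2)).
have c1 : continuous (fun z : R * R => 2 * z.1).
  by move=> z; apply: cvgM; [exact: cvg_cst|exact: cfst].
split.
- apply: (within_glue closedII).
  + by move=> z; exact: cfst.
  + apply: (@within_comp _ _ _ _ (I `*` I) (fun z : R * R => (2 * z.1, z.2))) => //.
      by apply: continuous_subspaceT; apply: cpair; [exact: c1|exact: csnd].
    by move=> z [[/= ? ?] ?]; split=> //=; apply: I_dbl.
  + apply: (@within_comp _ _ _ _ (I `*` I) (fun z : R * R => (2 * z.1 - 1, z.2))) => //.
      apply: continuous_subspaceT; apply: cpair; last exact: csnd.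
      by move=> z; apply: cvgB; [exact: c1|exact: cvg_cst].
    by move=> z [[/= ? ?] ?]; split=> //=; apply: I_dbl'.
  + move=> [s t] [/= Is It] ->; rewrite divff // subrr.
    by have [_ ->] := Hx _ It; have [-> _] := Kx _ It.
- move=> s Is /=; rewrite /cat_fun; case: ifPn => hs; first exact/H01/I_dbl.
  by apply/K01/I_dbl' => //; lra.
- move=> t It /=; rewrite invr_ge0 ler0n mulr0 ifF; last by apply/negbTE; lra.
  have -> : 2 * 1 - 1 = 1 :> R by lra.
  by split; [apply: (Hx _ It).1|apply: (Kx _ It).2].
Qed.

Lemma homotopic_rev f g : homotopic f g -> homotopic (loop_rev f) (loop_rev g).
Proof.
move=> [H [cH H01 Hx]]; exists (fun z => H (1 - z.1, z.2)); split.
- apply: (@within_comp _ _ _ _ (I `*` I) (fun z : R * R => (1 - z.1, z.2))) => //.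
    apply: continuous_subspaceT; apply: cpair; last exact: csnd.
    by move=> z; apply: cvgB; [exact: cvg_cst|exact: cfst].
  by move=> z [/= ? ?]; split=> //=; apply: I_comp.
- by move=> s Is /=; apply/H01/I_comp.
- by move=> t It /=; rewrite subr0 subrr; have [] := Hx _ It.
Qed.

Definition pi1_one : pi1 := \pi_pi1 loop_cst.
Definition pi1_mul (a b : pi1) : pi1 := \pi_pi1 (loop_cat (repr a) (repr b)).
Definition pi1_inv (a : pi1) : pi1 := \pi_pi1 (loop_rev (repr a)).

Lemma pi1_mulE f g : pi1_mul (\pi_pi1 f) (\pi_pi1 g) = \pi_pi1 (loop_cat f g).
Proof. by apply/pi1_eq/homotopic_cat; apply: repr_homotopic. Qed.

Lemma pi1_invE f : pi1_inv (\pi_pi1 f) = \pi_pi1 (loop_rev f).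
Proof. by apply/pi1_eq/homotopic_rev; apply: repr_homotopic. Qed.

Let cmin (a b : R -> R) : continuous a -> continuous b ->
  continuous (fun s => Num.min (a s) (b s)).
Proof. by move=> ca cb s; apply: continuous_min; [exact: ca|exact: cb]. Qed.

Let cmax (a b : R -> R) : continuous a -> continuous b ->
  continuous (fun s => Num.max (a s) (b s)).
Proof. by move=> ca cb s; apply: continuous_max; [exact: ca|exact: cb]. Qed.

Lemma pi1_mul1 : left_id pi1_one pi1_mul.
Proof.
elim/quotW => f; rewrite pi1_mulE; apply: pi1_eq.
apply: (@homotopic_reparam f (fun s => Num.max 0 (2 * s - 1)) id).
- exact: loop_cts.
- by apply: cmax => //; exact: cst_continuous.
- exact: c_id.
- by move=> s; rewrite !IE maxEle => Is; case: ifPn => ?; lra.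
- by [].
- move=> s Is; rewrite /= /cat_fun /= maxEle.
  case: ifPn => ?; case: ifPn => ? //; rewrite ?loop_0 //; last by exfalso; lra.
  by rewrite (_ : 2 * s - 1 = 0) ?loop_0 //; lra.
- by [].
- by rewrite maxEle; case: ifPn => ?; lra.
- by rewrite maxEle; case: ifPn => ?; lra.
Qed.

Lemma pi1_mulr1 : right_id pi1_one pi1_mul.
Proof.
elim/quotW => f; rewrite pi1_mulE; apply: pi1_eq.
apply: (@homotopic_reparam f (fun s => Num.min 1 (2 * s)) id).
- exact: loop_cts.
- by apply: cmin => //; exact: cst_continuous.
- exact: c_id.
- by move=> s; rewrite !IE minEle => Is; case: ifPn => ?; lra.
- by [].
- move=> s Is; rewrite /= /cat_fun /= minEle.
  case: ifPn => ?; case: ifPn => ? //; rewrite ?loop_1 //; last by exfalso; lra.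
  by rewrite (_ : 2 * s = 1) ?loop_1 //; lra.
- by [].
- by rewrite minEle; case: ifPn => ?; lra.
- by rewrite minEle; case: ifPn => ?; lra.
Qed.

Lemma pi1_mulV : left_inverse pi1_one pi1_inv pi1_mul.
Proof.
elim/quotW => f; rewrite pi1_invE pi1_mulE; apply: pi1_eq.
apply: (@homotopic_reparam f (fun s => Num.max (1 - 2 * s) (2 * s - 1)) (cst 1)).
- exact: loop_cts.
- apply: cmax => // s.
  by apply: cvgB; [exact: cvg_cst|exact: cmul2].
- exact: cst_continuous.
- by move=> s; rewrite !IE maxEle => Is; case: ifPn => ?; lra.
- by [].
- move=> s Is; rewrite /= /cat_fun /= maxEle.
  case: ifPn => ?; case: ifPn => ? //=; try (by exfalso; lra).
  by congr (f _); lra.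
- by move=> s _; rewrite /= loop_1.
- by rewrite maxEle; case: ifPn => ?; rewrite /cst; lra.
- by rewrite maxEle; case: ifPn => ?; rewrite /cst; lra.
Qed.

Lemma pi1_invK : involutive pi1_inv.
Proof.
elim/quotW => f; rewrite (pi1_invE f) pi1_invE; apply: pi1_eq.
apply: (@homotopic_reparam f id id) => //; try exact: c_id.
  exact: loop_cts.
by move=> s _ /=; rewrite opprB addrC subrK.
Qed.

Lemma pi1_mulVr : right_inverse pi1_one pi1_inv pi1_mul.
Proof. by move=> a; rewrite -{1}[a]pi1_invK pi1_mulV. Qed.

Lemma pi1_mulA : associative pi1_mul.
Proof.
elim/quotW => f; elim/quotW => g; elim/quotW => h; rewrite (pi1_mulE f g) (pi1_mulE g h).
rewrite (pi1_mulE (loop_cat f g)) pi1_mulE.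
apply/esym/pi1_eq.
apply: (@homotopic_reparam (loop_cat f (loop_cat g h))
  (fun s => Num.min (2 * s) (Num.min (s + 4^-1) (2^-1 * s + 2^-1))) id).
- exact: loop_cts.
- apply: cmin => //; apply: cmin.
    by move=> s; apply: cvgD; [exact: cvg_id|exact: cvg_cst].
  move=> s; apply: cvgD; last exact: cvg_cst.
  by apply: cvgM; [exact: cvg_cst|exact: cvg_id].
- exact: c_id.
- move=> s; rewrite !IE !minEle => Is.
  by case: (boolP (s + _ <= _)) => ?; case: ifPn => ?; lra.
- by [].
- move=> s; rewrite IE => Is; rewrite /= /cat_fun /= /cat_fun !minEle.
  case: (lerP s 4^-1) => s4.
    rewrite (_ : (s <= 2^-1) = true); last by lra.
    rewrite (_ : (s + 4^-1 <= 2^-1 * s + 2^-1) = true); last by lra.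
    rewrite (_ : (2 * s <= s + 4^-1) = true); last by lra.
    by rewrite (_ : (2 * s <= 2^-1) = true); last by lra.
  case: (lerP s 2^-1) => s2.
    rewrite (_ : (2 * s <= 2^-1) = false); last by apply/negbTE; lra.
    rewrite (_ : (s + 4^-1 <= 2^-1 * s + 2^-1) = true); last by lra.
    rewrite (_ : (2 * s <= s + 4^-1) = false); last by apply/negbTE; lra.
    rewrite (_ : (s + 4^-1 <= 2^-1) = false); last by apply/negbTE; lra.
    rewrite (_ : (2 * (s + 4^-1) - 1 <= 2^-1) = true); last by lra.
    by congr (g _); lra.
  rewrite (_ : (s + 4^-1 <= 2^-1 * s + 2^-1) = false); last by apply/negbTE; lra.
  rewrite (_ : (2 * s <= 2^-1 * s + 2^-1) = false); last by apply/negbTE; lra.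
  rewrite (_ : (2^-1 * s + 2^-1 <= 2^-1) = false); last by apply/negbTE; lra.
  rewrite (_ : (2 * (2^-1 * s + 2^-1) - 1 <= 2^-1) = false); last by apply/negbTE; lra.
  by congr (h _); lra.
- by [].
- by rewrite !minEle; case: (boolP (0 + _ <= _)) => ?; case: ifPn => ?; lra.
- by rewrite !minEle; case: (boolP (1 + _ <= _)) => ?; case: ifPn => ?; lra.
Qed.

HB.instance Definition _ :=
  isGroup.Build pi1 pi1_mulA pi1_mul1 pi1_mulr1 pi1_mulV pi1_mulVr.

End Based.
End FundamentalGroup.

Section CWComplex.
Variable R : realType.

Definition sqnorm (d : nat) (v : 'rV[R]_d) : R := \sum_(i < d) v 0 i ^+ 2.
Definition disk d : set 'rV[R]_d := [set v | sqnorm v <= 1].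
Definition open_disk d : set 'rV[R]_d := [set v | sqnorm v < 1].
Definition disk_boundary d : set 'rV[R]_d := [set v | sqnorm v = 1].

Arguments disk d : clear implicits.
Arguments open_disk d : clear implicits.
Arguments disk_boundary d : clear implicits.

(* For finitely many cells, the closure-finiteness and weak-topology axioms
   hold automatically, and so does the fact that the characteristic maps
   restrict to homeomorphisms of the open disks onto the open cells. *)
Record finite_CW (X : topologicalType) := FiniteCW {
  cell : finType;
  cell_dim : cell -> nat;
  char_map : forall e : cell, 'rV[R]_(cell_dim e) -> X;
  CW_hausdorff : hausdorff_space X;
  CW_continuous : forall e, {within disk (cell_dim e), continuous (@char_map e)};
  CW_injective : forall e, {in open_disk (cell_dim e) &, injective (@char_map e)};
  CW_partition : forall x, exists! e, (@char_map e @` open_disk (cell_dim e)) x;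
  CW_boundary : forall e v, disk_boundary (cell_dim e) v ->
    exists2 e', (cell_dim e' < cell_dim e)%N
              & (@char_map e' @` open_disk (cell_dim e')) (@char_map e v) }.

End CWComplex.

Section SingularHomology.
Variables (R : realType) (X : topologicalType).

Definition stdsimplex p : set 'rV[R]_p.+1 :=
  [set t | (forall i, 0 <= t 0 i) /\ \sum_i t 0 i = 1].

Arguments stdsimplex p : clear implicits.

Definition face_fun p (i : 'I_p.+2) (t : 'rV[R]_p.+1) : 'rV[R]_p.+2 :=
  \row_j (if unlift i j is Some l then t 0 l else 0).

Lemma face_subproof p (i : 'I_p.+2) (t : stdsimplex p) :
  face_fun i (val t) \in stdsimplex p.+1.
Proof.
case: t => t /= /[!inE] -[t0 t1]; split=> [j|].
  by rewrite mxE; case: unliftP.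
rewrite (bigD1_ord i) //= mxE unlift_none add0r -[RHS]t1.
by apply: eq_bigr => l _; rewrite mxE liftK.
Qed.

Definition face p (i : 'I_p.+2) (t : stdsimplex p) : stdsimplex p.+1 :=
  exist (fun x => x \in stdsimplex p.+1) _ (face_subproof i t).

Lemma face_continuous p (i : 'I_p.+2) : continuous (@face _ i).
Proof.
apply: continuous_comp_initial.
have -> : set_val \o @face _ i = face_fun i \o set_val by [].
move=> t; apply: continuous_comp; first exact: initial_continuous.
move=> U [P /= nP PU].
suff : \forall y \near set_val t, forall j, P 0 j (face_fun i y 0 j).
  by apply: filterS => y Py; apply: PU => a j; rewrite (ord1 a).
have nF : Filter (nbhs (set_val t)) by exact: nbhs_filter.
have := @filter_forall _ _ (fun j y => P 0 j (face_fun i y 0 j)) _ nF.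
apply => j; have := nP 0 j; rewrite mxE.
case E : (unlift i j) => [l|] nPl; last first.
  apply: (@filterS _ _ nF setT _ _ filterT) => y _; rewrite mxE E.
  exact: nbhs_singleton.
have := @coord_continuous R 1 p.+1 0 l (set_val t) _ nPl => H.
by apply: (@filterS _ _ nF _ _ _ H) => y /=; rewrite mxE E.
Qed.

HB.instance Definition _ p (i : 'I_p.+2) :=
  isContinuous.Build _ _ (@face _ i) (@face_continuous p i).

Definition singular_simplex p := continuousType (stdsimplex p) X.
Definition chains p := {malg int[singular_simplex p]}.

Definition bdry_simplex p (sigma : singular_simplex p.+1) : chains p :=
  \sum_(i < p.+2) << (-1) ^+ i *g (sigma \o @face _ i : singular_simplex p) >>.

Definition bdry p (c : chains p.+1) : chains p :=
  \sum_(sigma <- msupp c) bdry_simplex sigma *~ (c@_sigma).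

Lemma bdryEw p (d : {fset singular_simplex p.+1}) (c : chains p.+1) :
  (msupp c `<=` d)%fset ->
  bdry c = \sum_(sigma <- d) bdry_simplex sigma *~ (c@_sigma).
Proof.
move=> cd; rewrite /bdry; apply: big_fset_incl => // s _ /mcoeff_outdom ->.
by rewrite mulr0z.
Qed.

Lemma bdry_is_additive p : zmod_morphism (@bdry p).
Proof.
move=> a b; pose d := (msupp a `|` msupp b)%fset.
rewrite (bdryEw (msuppB_le a b)) (@bdryEw _ d a) ?fsubsetUl //.
rewrite (@bdryEw _ d b) ?fsubsetUr // -sumrB.
by apply: eq_bigr => s _; rewrite mcoeffB mulrzBr.
Qed.

HB.instance Definition _ p :=
  GRing.isZmodMorphism.Build _ _ (@bdry p) (@bdry_is_additive p).

Definition is_cycle p : {pred chains p.+1} := [pred c | bdry c == 0].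

Lemma cycle_zmod_closed p : zmod_closed (@is_cycle p).
Proof.
split=> [|a b]; rewrite !inE ?raddf0 // => /eqP a0 /eqP b0.
by rewrite (raddfB (@bdry p)) /= a0 b0 subrr.
Qed.

HB.instance Definition _ p :=
  GRing.isZmodClosed.Build _ (@is_cycle p) (@cycle_zmod_closed p).

Record cycles p := Cycle { cycle_val :> chains p.+1; _ : cycle_val \in @is_cycle p }.
HB.instance Definition _ p := [isSub for @cycle_val p].
HB.instance Definition _ p := [Choice of cycles p by <:].
HB.instance Definition _ p := [SubChoice_isSubZmodule of cycles p by <:].

Definition is_boundary p : {pred cycles p} :=
  [pred z | `[< exists b : chains p.+2, bdry b = val z >]].

Lemma boundary_zmod_closed p : zmod_closed (@is_boundary p).
Proof.
split=> [|y z]; rewrite !inE; first by exists 0; rewrite raddf0.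
move=> [b yb] [c zc]; exists (b - c).
by rewrite (raddfB (@bdry p.+1)) /= yb zc.
Qed.

HB.instance Definition _ p :=
  GRing.isZmodClosed.Build _ (@is_boundary p) (@boundary_zmod_closed p).

(* H_(p+1)(X; Z) *)
Definition homologyS p := Quotient.quot (@is_boundary p).
HB.instance Definition _ p := GRing.Zmodule.on (homologyS p).

Definition H1 := homologyS 0.
HB.instance Definition _ := GRing.Zmodule.on H1.

Variable x0 : X.

Definition loop_simplex_fun (f : loop R x0) (t : stdsimplex 1) : X := f (val t 0 1).

Lemma loop_simplex_continuous (f : loop R x0) : continuous (loop_simplex_fun f).
Proof.
rewrite (_ : loop_simplex_fun f =
  sigL (stdsimplex 1) (f \o (fun t : 'rV[R]_2 => t 0 1))) //.
apply/subspace_sigL_continuousP.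
have wc := @within_comp 'rV[R]_2 R X (stdsimplex 1) `[0, 1]%classic (fun t : 'rV[R]_2 => t 0 1) f.
apply: wc.
- by apply: continuous_subspaceT; exact: coord_continuous.
- exact: loop_cts.
- move=> t [t0]; rewrite 2!big_ord_recl big_ord0 addr0 => t1 /=.
rewrite in_itv /= t0 /= -t1 (_ : lift _ _ = 1) ?lerDr ?t0 //.
exact: val_inj.
Qed.

HB.instance Definition _ (f : loop R x0) :=
  isContinuous.Build _ _ (loop_simplex_fun f) (@loop_simplex_continuous f).

Definition loop_simplex (f : loop R x0) : singular_simplex 1 := loop_simplex_fun f.

Lemma loop_cycle_subproof (f : loop R x0) :
  (<< loop_simplex f >> : chains 1) \in @is_cycle 0.
Proof.
rewrite inE /bdry msuppU oner_eq0 big_seq_fset1 mcoeffUU mulr1z /bdry_simplex.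
rewrite 2!big_ord_recl big_ord0 addr0 expr0 expr1.
have vtx i : (loop_simplex f \o @face 0 i : singular_simplex 0) = cst x0.
  apply/continuousEP => t; have [_] := set_mem (valP t).
  rewrite big_ord1 => t1; rewrite /= /loop_simplex_fun /= mxE.
  case: unliftP => [l|]; last by rewrite loop_0.
  by rewrite (ord1 l) t1 loop_1.
by rewrite !vtx monalgUN subrr.
Qed.

Definition loop_cycle (f : loop R x0) : cycles 0 := Cycle (loop_cycle_subproof f).

Definition hurewicz (a : pi1 R x0) : H1 :=
  \pi_(Quotient.quot (@is_boundary 0)) (loop_cycle (repr a)).

End SingularHomology.

(* x_i is encoded as (i, true) and its inverse as (i, false); a word stands for
   the element of the free group that it represents. *)
Definition word (q : nat) := seq ('I_q * bool).

Section Presentations.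
Variables (G : groupType) (q s : nat).
Implicit Types (x : 'I_q -> G) (r : 'I_s -> word q) (u v w : word q).

Definition eval_word x w : G :=
  foldr (fun a g => ((if a.2 then x a.1 else (x a.1)^-1) * g)%g) 1%g w.

(* equality in the group with generators x_i and relators r_i *)
Inductive rel_eq r : word q -> word q -> Prop :=
| rel_eq_refl w : rel_eq r w w
| rel_eq_sym v w : rel_eq r v w -> rel_eq r w v
| rel_eq_trans u v w : rel_eq r u v -> rel_eq r v w -> rel_eq r u w
| rel_eq_free u v i b : rel_eq r (u ++ v) (u ++ [:: (i, b); (i, ~~ b)] ++ v)
| rel_eq_rel u v i : rel_eq r (u ++ v) (u ++ r i ++ v).

End Presentations.

Record presentation (G : groupType) := Presentation {
  ngens : nat;
  nrels : nat;
  gens : 'I_ngens -> G;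
  rels : 'I_nrels -> word ngens;
  gens_generate : forall g, exists w, eval_word gens w = g;
  rels_define : forall w, eval_word gens w = 1%g <-> rel_eq rels w [::] }.

Definition isomorphic_groups (G H : groupType) : Prop :=
  exists f : G -> H, bijective f /\ {morph f : a b / (a * b)%g}.

Section Fox.
Variable q : nat.

(* The elements of Z[F_q] are represented by integral combinations of words;
   the rules are d(a w) = d a + a (d w) and d(x_j^-1) = - x_j^-1. *)
Definition fox_lmul (a : 'I_q * bool) (g : {malg int[word q]}) : {malg int[word q]} :=
  \sum_(w <- msupp g) << g@_w *g a :: w >>.

Fixpoint fox (j : 'I_q) (w : word q) : {malg int[word q]} :=
  if w is (i, b) :: w' then
    (if i == j then (if b then << [::] >> else - << [:: (i, false)] >>) else 0)
    + fox_lmul (i, b) (fox j w')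
  else 0.

End Fox.

(* The Laurent polynomial ring A[t_1^{+-1}, ..., t_n^{+-1}]; << a *g m >> is the
   monomial a t^m. *)
Definition laurent (n : nat) (A : comNzRingType) := {malg A['rV[int]_n]}.

Section LaurentRing.
Variables (n : nat) (A : comNzRingType).
Local Notation L := (laurent n A).
Implicit Types (f g h : L) (k m : 'rV[int]_n).

HB.instance Definition _ := GRing.Lmodule.on L.

Definition lmul f g : L :=
  \sum_(k <- msupp f) \sum_(m <- msupp g) << f@_k * g@_m *g k + m >>.

Definition lone : L := << 1 *g 0 >>.

Lemma lmulw (d e : {fset 'rV[int]_n}) f g :
  (msupp f `<=` d)%fset -> (msupp g `<=` e)%fset ->
  lmul f g = \sum_(k <- d) \sum_(m <- e) << f@_k * g@_m *g k + m >>.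
Proof.
move=> fd ge; rewrite /lmul (big_fset_incl _ fd) /=.
  apply/eq_bigr=> k _; apply/big_fset_incl => // m _ /mcoeff_outdom ->.
  by rewrite mulr0 monalgU0.
move=> k _ /mcoeff_outdom fk; rewrite big1 // => m _.
by rewrite fk mul0r monalgU0.
Qed.

Lemma lmulC : commutative lmul.
Proof.
move=> f g; rewrite /lmul exchange_big; apply: eq_bigr => k _.
by apply: eq_bigr => m _; rewrite mulrC addrC.
Qed.

Lemma lmul0g : left_zero 0 lmul.
Proof. by move=> g; rewrite /lmul msupp0 big_seq_fset0. Qed.

Lemma lmul1g : left_id lone lmul.
Proof.
move=> g; rewrite (lmulw msuppU_le (fsubset_refl _)) big_seq_fset1.
by rewrite [RHS]monalgE; apply: eq_bigr => k _; rewrite mcoeffUU mul1r add0r.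
Qed.

Lemma lmulDl : left_distributive lmul +%R.
Proof.
move=> f g h; pose d := (msupp f `|` msupp g)%fset.
rewrite (lmulw (msuppD_le f g) (fsubset_refl (msupp h))).
rewrite (@lmulw d (msupp h) f h) ?fsubsetUl // (@lmulw d (msupp h) g h) ?fsubsetUr //.
rewrite -big_split /=; apply/eq_bigr => k _.
rewrite -big_split /=; apply/eq_bigr => m _.
by rewrite mcoeffD mulrDl monalgUD.
Qed.

Lemma lmulUU a b k m : lmul << a *g k >> << b *g m >> = << a * b *g k + m >>.
Proof. by rewrite (lmulw msuppU_le msuppU_le) !big_seq_fset1 !mcoeffUU. Qed.

Lemma lmul_suml (I : Type) (r : seq I) (F : I -> L) g :
  lmul (\sum_(i <- r) F i) g = \sum_(i <- r) lmul (F i) g.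
Proof. exact: (big_morph (lmul^~ g) (fun _ _ => lmulDl _ _ _) (lmul0g _)). Qed.

Lemma lmul_sumr (I : Type) (r : seq I) (F : I -> L) g :
  lmul g (\sum_(i <- r) F i) = \sum_(i <- r) lmul g (F i).
Proof. by rewrite lmulC lmul_suml; apply: eq_bigr => i _; rewrite lmulC. Qed.

Lemma lmulA : associative lmul.
Proof.
move=> f g h.
have mon2 a b k m : lmul << a *g k >> (lmul << b *g m >> h) =
    lmul (lmul << a *g k >> << b *g m >>) h.
  rewrite lmulUU [h]monalgE (lmul_sumr _ _ << b *g m >>) !lmul_sumr.
  apply: eq_bigr => l _.
  by rewrite !lmulUU mulrA addrA.
have mon1 a k : lmul << a *g k >> (lmul g h) = lmul (lmul << a *g k >> g) h.
  rewrite [g]monalgE (lmul_suml _ _ h) !(lmul_sumr _ _ << a *g k >>).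
  rewrite (lmul_suml _ _ h).
  by apply: eq_bigr => m _; exact: mon2.
rewrite [f]monalgE (lmul_suml _ _ (lmul g h)) (lmul_suml _ _ g) (lmul_suml _ _ h).
by apply: eq_bigr => k _; exact: mon1.
Qed.

Lemma lone_neq0 : lone != 0.
Proof. by rewrite monalgU_eq0 oner_eq0. Qed.

HB.instance Definition _ := GRing.Zmodule_isComNzRing.Build L
  lmulA lmulC lmul1g lmulDl lone_neq0.

End LaurentRing.

Definition map_laurent n (A B : comNzRingType) (f : A -> B) (g : laurent n A) :
    laurent n B :=
  \sum_(m <- msupp g) << f g@_m *g m >>.

Definition laurent_eval n (K : fieldType) (t : 'rV[K]_n) (g : laurent n K) : K :=
  \sum_(m <- msupp g) g@_m * \prod_(i < n) t 0 i ^ m 0 i.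

Section Ideals.
Variable A : comNzRingType.

Definition gen_ideal (S : set A) : set A :=
  [set x | exists (l : nat) (a g : 'I_l -> A),
             (forall i, S (g i)) /\ x = \sum_i a i * g i].

Definition radical (J : set A) : set A := [set x | exists l, J (x ^+ l.+1)].

(* For l = 0 the only minor is 1 *)
Definition minors s q (l : nat) (M : 'M[A]_(s, q)) : set A :=
  [set x | exists (f : 'I_l -> 'I_s) (g : 'I_l -> 'I_q),
    [/\ {homo f : i j / (i < j)%N}, {homo g : i j / (i < j)%N}
      & x = \det (mxsub f g M)]].

End Ideals.

Section Zariski.
Variables (R : realType) (n : nat).
Local Notation C := R[i].
Implicit Types Z V : set 'rV[C]_n.

Definition torus : set 'rV[C]_n := [set t | forall i, t 0 i != 0].

Definition zero_locus (S : set (laurent n C)) : set 'rV[C]_n :=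
  [set t | torus t /\ forall g, S g -> laurent_eval t g = 0].

Definition zariski_closed Z : Prop := exists S, Z = zero_locus S.

Definition zariski_irreducible Z : Prop :=
  Z !=set0 /\ forall Z1 Z2, zariski_closed Z1 -> zariski_closed Z2 ->
    Z `<=` Z1 `|` Z2 -> Z `<=` Z1 \/ Z `<=` Z2.

Definition irreducible_closed Z : Prop := zariski_closed Z /\ zariski_irreducible Z.

Definition irreducible_components V : set (set 'rV[C]_n) :=
  [set Z | [/\ irreducible_closed Z, Z `<=` V &
    forall Z', irreducible_closed Z' -> Z `<=` Z' -> Z' `<=` V -> Z' = Z]].

(* chains Z = F 0 < F 1 < ... < F l of irreducible closed subsets *)
Definition codim_chain Z (l : nat) : Prop :=
  exists F : nat -> set 'rV[C]_n,
    [/\ F 0%N = Z, forall i, (i <= l)%N -> irreducible_closed (F i)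
      & forall i, (i < l)%N -> F i `<` F i.+1].

Definition codim Z : \bar R := ereal_sup [set l%:R%:E | l in codim_chain Z].

Definition torsion_points (p : nat) : set 'rV[C]_n :=
  [set t | forall i, t 0 i ^+ p = 1].

End Zariski.

(* The lists (f a)_{a in A} and (g b)_{b in B} are equal up to reordering. *)
Definition same_list (T U L : Type) (A : set T) (f : T -> L) (B : set U) (g : U -> L) :=
  exists phi : T -> U, set_bij A B phi /\ forall a, A a -> g (phi a) = f a.

Section CharacteristicVarieties.
Variables (R : realType) (X : topologicalType) (x0 : X) (n : nat).
Variable psi : H1 R X -> 'rV[int]_n.
Variable P : presentation (pi1 R x0).
Local Notation C := R[i].

Definition abelianize (g : {malg int[word (ngens P)]}) : laurent n int :=
  \sum_(w <- msupp g) << g@_w *g psi (hurewicz (eval_word (@gens _ P) w)) >>.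

Definition alexander_matrix : 'M[laurent n int]_(nrels P, ngens P) :=
  \matrix_(i, j) abelianize (fox j (rels i)).

(* The truncated subtraction makes E_k the unit ideal for k >= ngens P *)
Definition determinantal_ideal (k : nat) : set (laurent n int) :=
  gen_ideal (minors (ngens P - k) alexander_matrix).

Definition determinantal_idealC (k : nat) : set (laurent n C) :=
  gen_ideal (map_laurent intr @` determinantal_ideal k).

Definition char_variety (k : nat) : set 'rV[C]_n :=
  zero_locus (radical (determinantal_idealC k)).

Definition Tors (p k : nat) : nat :=
  #|` fset_set (@torsion_points R n p `&` char_variety k)|.

End CharacteristicVarieties.

(* Main.v *)
Require Import Defs.
From HB Require Import structures.
From mathcomp Require Import all_boot all_order all_algebra finmap.
From mathcomp Require Import complex monalg.
From mathcomp Require Import all_classical all_reals all_analysis.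
From mathcomp Require Import generic_quotient ring_quotient.
From mathcomp Require Import lra ring zify.

Set Implicit Arguments.
Unset Strict Implicit.
Unset Printing Implicit Defensive.
Import Order.TTheory GRing.Theory Num.Theory.
Import numFieldNormedType.Exports.

Local Open Scope classical_set_scope.
Local Open Scope ring_scope.

(** Evaluate the Alexander matrix at a point t of the torus. Such a point is a
    character of the fundamental group G, g |-> t^[g], and Fox's formula
    d(w) = sum_j (dw/dx_j) d(x_j) says that the kernel of the evaluated matrix is
    the space of crossed homomorphisms from G to the field on which G acts through
    this character: a vector of values on the generators extends to G exactly when
    it is killed by the derivatives of the relators. All minors of size q - k vanish
    at t if and only if this kernel has dimension greater than k. Hence V_k is the
    set of the characters which have more than k independent crossed homomorphisms
    ([char_variety_crossed]), a description by the group alone. No comparison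
    of presentations is involved.

    It remains to compare the two tori of characters. By the Hurewicz theorem in
    degree one, the coordinate map from G to Z^n given by psi is universal among
    homomorphisms from G to free abelian groups ([h1_coord_factor],
    [h1_coord_generates]). An isomorphism of fundamental groups therefore induces two
    mutually inverse integral matrices ([h1_coord_transfer]), and dually two inverse
    monomial maps between the tori, which exchange the characteristic varieties. A
    monomial map pulls Laurent polynomials back to Laurent polynomials, so these maps
    are homeomorphisms for the Zariski topology: they match irreducible components and
    chains of irreducible closed sets, hence codimensions. They also fix the point 1
    and preserve p-torsion.

    The Hurewicz theorem is proved by whiskering. Since a connected finite CW complex
    is path-connected ([CW_joined]), one can glue to each vertex of a singular simplex
    a path from the basepoint. Doing this compatibly with faces ([whisker_face])
    turns 1-simplices into based loops and 2-simplices into relations between these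
    loops ([homotopic_triangle]), which shows that a homomorphism from G to an
    abelian group extends to 1-chains and vanishes on boundaries. The whiskers cancel in a
    cycle, so that classes of loops generate the homology. *)

(** * Additive maps on free modules *)

Section LinearExtension.
Variables (K : choiceType) (A V : zmodType).
Implicit Types (F : K -> A -> V) (g : {malg A[K]}).

Definition malg_ext F g : V := \sum_(k <- msupp g) F k g@_k.

Lemma malg_extEw F (d : {fset K}) g : (forall k, zmod_morphism (F k)) ->
  (msupp g `<=` d)%fset -> malg_ext F g = \sum_(k <- d) F k g@_k.
Proof.
move=> Fa gd; apply: big_fset_incl => // k _ /mcoeff_outdom ->.
by rewrite -(subrr 0) Fa subrr.
Qed.

Lemma malg_ext_is_zmod_morphism F : (forall k, zmod_morphism (F k)) ->
  zmod_morphism (malg_ext F).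
Proof.
move=> Fa g h; pose d := (msupp g `|` msupp h)%fset.
rewrite (malg_extEw Fa (msuppB_le g h)) (@malg_extEw _ d g) ?fsubsetUl //.
rewrite (@malg_extEw _ d h) ?fsubsetUr // -sumrB.
by apply: eq_bigr => k _; rewrite mcoeffB Fa.
Qed.

Lemma malg_extU F k a : (forall k, zmod_morphism (F k)) ->
  malg_ext F << a *g k >> = F k a.
Proof.
by move=> Fa; rewrite (malg_extEw Fa msuppU_le) big_seq_fset1 mcoeffUU.
Qed.

End LinearExtension.

Definition additive_of (U V : zmodType) (f : U -> V) (fB : zmod_morphism f) :
    {additive U -> V} :=
  HB.pack_for {additive U -> V} f (GRing.isZmodMorphism.Build _ _ f fB).

Lemma mulrz_zmod_morphism (V : zmodType) (v : V) : zmod_morphism (fun a : int => v *~ a).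
Proof. by move=> a b; rewrite mulrzBr. Qed.

Lemma malg_lift (K : choiceType) (V : zmodType) (F : K -> V) :
  exists Psi : {additive {malg int[K]} -> V}, forall k, Psi << k >> = F k.
Proof.
have Fa k : zmod_morphism (fun a : int => F k *~ a) by exact: mulrz_zmod_morphism.
by exists (additive_of (malg_ext_is_zmod_morphism Fa)) => k; rewrite /= malg_extU ?mulr1z.
Qed.

Lemma malg_intU (K : choiceType) (k : K) (a : int) :
  << a *g k >> = << k >> *~ a :> {malg int[K]}.
Proof. by rewrite -(raddfMz (mkmalgU k)) intz. Qed.

Lemma malg_additive_eq (K : choiceType) (V : zmodType) (A B : {additive {malg int[K]} -> V}) :
  (forall k, A << k >> = B << k >>) -> A =1 B.
Proof.
move=> AB g; rewrite [g]monalgE !raddf_sum; apply: eq_bigr => k _.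
by rewrite malg_intU !raddfMz AB.
Qed.

(** * Continuous maps out of intervals and simplices *)

Section SimplexMaps.
Variables (R : realType).
Implicit Types X : topologicalType.

Lemma continuous_max0 (T : topologicalType) (g : T -> R) :
  continuous g -> continuous (fun s => Num.max 0 (g s)).
Proof.
move=> cg s; apply: (@continuous_max R _ (fun=> 0) g s); first exact: cst_continuous.
exact: cg.
Qed.

(** Precomposing with this retraction of the line onto the unit interval turns
    maps that are continuous on the interval into globally continuous ones. *)
Definition clip (s : R) : R := Num.max 0 (Num.min 1 s).

Lemma clip_itv s : 0 <= clip s <= 1.
Proof. by rewrite /clip maxEle minEle; do 2! case: ifPn; lra. Qed.

Lemma clip_id s : 0 <= s <= 1 -> clip s = s.
Proof. by rewrite /clip maxEle minEle; do 2! case: ifPn; lra. Qed.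

Lemma clip_continuous : continuous clip.
Proof.
apply: continuous_max0 => s.
by apply: continuous_min; [exact: cvg_cst|exact: cvg_id].
Qed.

Definition mkcont (T U : topologicalType) (f : T -> U) (cf : continuous f) :
    continuousType T U :=
  HB.pack_for (continuousType T U) f (isContinuous.Build _ _ f cf).

Lemma comp_within_continuous (T U V : topologicalType) (B : set U) (f : T -> U)
    (g : U -> V) : continuous f -> {within B, continuous g} ->
  (forall x, B (f x)) -> continuous (g \o f).
Proof.
move=> cf /subspace_continuousP cg fB x.
apply: (@cvg_comp _ _ _ f g _ (within B (nbhs (f x)))); last exact/cg/fB.
move=> W /= fW; have /= := cf x _ fW.
by rewrite !nbhs_simpl /=; apply: filterS => y; apply; apply: fB.
Qed.

Lemma within_clip X (f : R -> X) : {within `[0, 1]%classic, continuous f} ->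
  continuous (f \o clip).
Proof.
move=> cf; apply: (comp_within_continuous clip_continuous cf) => s /=.
by rewrite in_itv; exact: clip_itv.
Qed.

Lemma continuous_sum (T : topologicalType) (E : normedModType R) n
    (F : 'I_n -> T -> E) : (forall i, continuous (F i)) ->
  continuous (fun x => \sum_i F i x).
Proof.
move=> cF; elim: n => [|n IH] in F cF *.
  rewrite (_ : (fun _ => _) = cst 0); first exact: cst_continuous.
  by apply/funext => x; rewrite big_ord0.
rewrite (_ : (fun _ => _) =
    (fun x => F ord0 x + \sum_(i < n) F (lift ord0 i) x)); last first.
  by apply/funext => x; rewrite big_ord_recl.
move=> x; apply: cvgD; first exact: cF.
by apply: IH => i; exact: cF.
Qed.

Lemma continuous_row (T : topologicalType) n (v : T -> 'rV[R]_n) :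
  (forall j, continuous (fun x => v x 0 j)) -> continuous v.
Proof.
move=> cv x U [P /= nP PU].
suff : \forall y \near x, forall j, P 0 j (v y 0 j).
  by apply: filterS => y Py; apply: PU => a j; rewrite (ord1 a).
by apply: filter_forall => j; apply: cv; apply: nP.
Qed.

Local Notation simplex p := (@stdsimplex R p).

Lemma bary_continuous p (i : 'I_p.+1) : continuous (fun t : simplex p => val t 0 i).
Proof.
move=> t; apply: (@continuous_comp _ _ _ (set_val : simplex p -> _) (fun v => v 0 i)).
  exact: initial_continuous.
exact: coord_continuous.
Qed.

Lemma bary_ge0 p (t : simplex p) i : 0 <= val t 0 i.
Proof. by have [+ _] := set_mem (valP t); apply. Qed.

Lemma bary_sum p (t : simplex p) : \sum_i val t 0 i = 1.
Proof. by have [] := set_mem (valP t). Qed.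

Lemma simplex_continuous (T : topologicalType) p (f : T -> simplex p) :
  (forall j, continuous (fun x => val (f x) 0 j)) -> continuous f.
Proof. by move=> cf; apply: continuous_comp_initial; apply: continuous_row. Qed.

Section Affine.
Variables (X : topologicalType) (E : normedModType R) (H : E -> X).
Hypothesis cH : continuous H.

(** Simplices that factor through a map H from a vector space E: E is the line
    for subdivided paths and the plane for homotopies. Faces just drop a vertex,
    which makes all the chain computations below formal. *)
Lemma affine_continuous p (P : 'I_p.+1 -> E) :
  continuous (fun t : simplex p => H (\sum_i val t 0 i *: P i)).
Proof.
move=> t; apply: (@continuous_comp _ _ _ (fun t : simplex p => \sum_i val t 0 i *: P i) H);
  last exact: cH.
by apply: continuous_sum => i {}t; apply: continuousZr_tmp; exact: bary_continuous.
Qed.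

Definition affine p (P : 'I_p.+1 -> E) : singular_simplex R X p :=
  mkcont (@affine_continuous p P).

Lemma affine_face p (P : 'I_p.+2 -> E) i :
  (affine P \o @face R p i : singular_simplex R X p) = affine (P \o lift i).
Proof.
apply/continuousEP => t /=; congr H; rewrite (bigD1_ord i) //= mxE unlift_none.
by rewrite scale0r add0r; apply: eq_bigr => j _; rewrite mxE liftK.
Qed.

End Affine.
End SimplexMaps.

(** * Homologous 1-chains *)

Section Homologous.
Variables (R : realType) (X : topologicalType).
Local Notation chains p := (@chains R X p).
Local Notation simp p := (@singular_simplex R X p).
Implicit Types (c d : chains 1).

Lemma bdryU p (s : simp p.+1) a : bdry << a *g s >> = bdry_simplex s *~ a.
Proof. exact: (malg_extU _ _ (fun s => mulrz_zmod_morphism (bdry_simplex s))). Qed.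

Definition homologous c d := exists b : chains 2, bdry b = c - d.

Lemma homologous_refl c : homologous c c.
Proof. by exists 0; rewrite raddf0 subrr. Qed.

Lemma homologous_sym c d : homologous c d -> homologous d c.
Proof. by case=> b bE; exists (- b); rewrite raddfN /= bE opprB. Qed.

Lemma homologous_trans d c e : homologous c d -> homologous d e -> homologous c e.
Proof. by move=> [b bE] [b' bE']; exists (b + b'); rewrite raddfD /= bE bE' addrA subrK. Qed.

Lemma homologousD c d c' d' : homologous c d -> homologous c' d' ->
  homologous (c + c') (d + d').
Proof.
by move=> [b bE] [b' bE']; exists (b + b'); rewrite raddfD /= bE bE' opprD addrACA.
Qed.

Lemma homologousMz c d (m : int) : homologous c d -> homologous (c *~ m) (d *~ m).
Proof. by move=> [b bE]; exists (b *~ m); rewrite raddfMz /= bE mulrzBl. Qed.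

Lemma homologous_sum (I : Type) (r : seq I) (F G : I -> chains 1) :
  (forall i, homologous (F i) (G i)) ->
  homologous (\sum_(i <- r) F i) (\sum_(i <- r) G i).
Proof.
move=> FG; elim/big_ind2: _ => //; first exact: homologous_refl.
by move=> *; exact: homologousD.
Qed.

Section Segments.
Variables (E : normedModType R) (H : E -> X).
Hypothesis cH : continuous H.

Definition seg (a b : E) : simp 1 := affine cH (fun i => nth 0 [:: a; b] i).
Definition tri (a b c : E) : simp 2 := affine cH (fun i => nth 0 [:: a; b; c] i).

Lemma segE a b (t : @stdsimplex R 1) : seg a b t = H (val t 0 0 *: a + val t 0 1 *: b).
Proof. by rewrite /= 2!big_ord_recl big_ord0 addr0 /= (_ : lift _ _ = 1) //; exact: val_inj. Qed.

Lemma bdry_tri (a b c : E) :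
  bdry << tri a b c >> = << seg b c >> - << seg a c >> + << seg a b >>.
Proof.
rewrite bdryU mulr1z /bdry_simplex 3!big_ord_recl big_ord0 addr0.
rewrite !affine_face /= expr0 expr1 sqrrN expr1n monalgUN addrA.
by congr (<< _ >> - << _ >> + << _ >>); congr (affine _ _); apply/funext => -[[|[|]] ?].
Qed.

(** The degenerate triangle with vertices a, b, c has this relation as its
    boundary, in whatever order a, b, c lie: subdivision and reversal of paths
    are both instances. *)
Lemma homologous_seg_cat (a b c : E) : homologous (<< seg a b >> + << seg b c >>) << seg a c >>.
Proof. by exists << tri a b c >>; rewrite bdry_tri addrAC [X in X - _]addrC. Qed.

Lemma homologous_seg_cst a : homologous << seg a a >> 0.
Proof. by have [b] := homologous_seg_cat a a a; rewrite addrK => bE; exists b; rewrite subr0. Qed.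

Lemma homologous_seg_rev a b : homologous << seg b a >> (- << seg a b >>).
Proof.
have := homologous_trans (homologous_seg_cat a b a) (homologous_seg_cst a).
by case=> c; rewrite subr0 => cE; exists c; rewrite cE opprK addrC.
Qed.

End Segments.

Lemma unit_bary (t : @stdsimplex R 1) : val t 0 0 = 1 - val t 0 1.
Proof.
have := bary_sum t; rewrite 2!big_ord_recl big_ord0 addr0.
by rewrite (_ : lift _ _ = 1) ?[ord0]/(0 : 'I_2); [move=> <-; rewrite addrK|exact: val_inj].
Qed.

Lemma bary_le1 p (t : @stdsimplex R p) i : 0 <= val t 0 i <= 1.
Proof.
rewrite bary_ge0 -(bary_sum t) (bigD1 i) //= lerDl.
by apply: sumr_ge0 => j _; exact: bary_ge0.
Qed.

Variable x0 : X.
Implicit Types f g : loop R x0.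

Lemma clip_loop_continuous f : continuous (f \o @clip R).
Proof. exact/within_clip/loop_cts. Qed.

Lemma loop_seg f (p : R -> X) (cp : continuous p) a b :
  (forall s, 0 <= s <= 1 -> f s = p (a + (b - a) * s)) ->
  loop_simplex f = seg cp a b.
Proof.
move=> fp; apply/continuousEP => t; rewrite segE unit_bary /= /loop_simplex_fun.
rewrite fp ?bary_le1 //; congr p; rewrite /GRing.scale /=; ring.
Qed.

(** Cut the square of the homotopy along its diagonal. The two triangles share
    the diagonal and the vertical sides are constant, so what remains is the
    difference of the two horizontal sides. *)
Lemma homotopic_homologous f g : homotopic f g ->
  homologous << loop_simplex f >> << loop_simplex g >>.
Proof.
move=> [H [cH H01 Hx]].
(* H is only continuous on the square; clipping makes it continuous on the plane *)
have cK : continuous (H \o (fun z => (clip z.1, clip z.2))).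
  have c1 : continuous (fun z : R * R => clip z.1).
    by move=> z; apply: continuous_comp; [exact: cvg_fst|exact: clip_continuous].
  have c2 : continuous (fun z : R * R => clip z.2).
    by move=> z; apply: continuous_comp; [exact: cvg_snd|exact: clip_continuous].
  have cc : continuous (fun z : R * R => (clip z.1, clip z.2)).
    by move=> z; exact: (cvg_pair (c1 z) (c2 z)).
  apply: (comp_within_continuous cc cH) => z /=.
  by rewrite !in_itv /= !clip_itv.
have clip0 : @clip R 0 = 0 by apply: clip_id; lra.
have clip1 : @clip R 1 = 1 by apply: clip_id; lra.
have It (t : @stdsimplex R 1) : `[0, 1]%classic (val t 0 1).
  by rewrite /= in_itv /= bary_le1.
have s1 : seg cK (0, 0) (1, 0) = loop_simplex f.
  apply/continuousEP => t; rewrite segE unit_bary /= /loop_simplex_fun.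
  rewrite -(H01 _ (It t)).1; congr H; rewrite !scaler0 addr0 add0r clip0.
  by rewrite /GRing.scale /= mulr1 clip_id ?bary_le1.
have s2 : seg cK (0, 1) (1, 1) = loop_simplex g.
  apply/continuousEP => t; rewrite segE unit_bary /= /loop_simplex_fun.
  rewrite -(H01 _ (It t)).2; congr H; rewrite !scaler0 add0r.
  by rewrite /GRing.scale /= !mulr1 clip_id ?bary_le1 // subrK clip1.
have s3 : seg cK (1, 0) (1, 1) = seg cK (0, 0) (0, 1).
  apply/continuousEP => t; rewrite !segE unit_bary /= /GRing.scale /=.
  rewrite !mulr0 !mulr1 !add0r subrK clip0 clip1.
  by rewrite !(Hx _ _).2 ?(Hx _ _).1 //= in_itv /= clip_itv.
have := homologousD (homologous_refl (- << seg cK (1, 0) (1, 1) >>))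
  (homologous_trans (homologous_seg_cat cK (0,0) (1,0) (1,1))
  (homologous_sym (homologous_seg_cat cK (0,0) (0,1) (1,1)))).
by rewrite s1 s2 s3 addrC addrK addKr.
Qed.

Lemma loop_cat_homologous f g : homologous << loop_simplex (loop_cat f g) >>
  (<< loop_simplex f >> + << loop_simplex g >>).
Proof.
have cp := @clip_loop_continuous (loop_cat f g).
have := homologous_sym (homologous_seg_cat cp 0 (2^-1) 1).
have -> : seg cp 0 1 = loop_simplex (loop_cat f g).
  apply/esym/loop_seg => s s01 /=.
  by rewrite subr0 mul1r add0r clip_id.
have -> : seg cp 0 2^-1 = loop_simplex f.
  apply/esym/loop_seg => s s01 /=; rewrite clip_id; last lra.
  rewrite /cat_fun ifT; last lra.
  by congr (f _); lra.
have -> // : seg cp 2^-1 1 = loop_simplex g.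
apply/esym/loop_seg => s s01 /=; rewrite clip_id; last lra.
rewrite /cat_fun; case: ifPn => h; last by congr (g _); lra.
have -> : s = 0 by lra.
by rewrite loop_0 mulr0 addr0 divff // loop_1.
Qed.

End Homologous.

(** * Whiskering simplices to the basepoint *)

Section Whisker.
Variables (R : realType) (X : topologicalType).
Local Notation simplex p := (@stdsimplex R p).
Local Notation simp p := (@singular_simplex R X p).

Lemma simplex_eq p (t u : simplex p) : (forall i, val t 0 i = val u 0 i) -> t = u.
Proof. by move=> tu; apply: val_inj; apply/rowP. Qed.

Lemma vertex_subproof p (i : 'I_p.+1) :
  (\row_j (j == i)%:R : 'rV[R]_p.+1) \in simplex p.
Proof.
rewrite inE; split=> [j|]; first by rewrite mxE ler0n.
rewrite (bigD1 i) //= mxE eqxx big1 ?addr0 // => j /negbTE ji.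
by rewrite mxE ji.
Qed.

Definition vertex p (i : 'I_p.+1) : simplex p :=
  exist (fun x => x \in simplex p) _ (vertex_subproof i).

Lemma vertexE p (i j : 'I_p.+1) : val (vertex i) 0 j = (j == i)%:R.
Proof. by rewrite /= mxE. Qed.

Lemma face_vertex p (i : 'I_p.+2) (j : 'I_p.+1) : face i (vertex j) = vertex (lift i j).
Proof.
apply: simplex_eq => l; rewrite vertexE /= mxE.
case: unliftP => [m ->|->]; last by rewrite (negbTE (neq_lift _ _)).
by rewrite mxE (inj_eq lift_inj).
Qed.

Lemma bary_corner p (t : simplex p) i j : j != i -> val t 0 j <= 1 - val t 0 i.
Proof.
move=> ji; rewrite -(bary_sum t) (bigD1 i) //= (bigD1 j) //= [X in X - _]addrC addrK lerDl.
by apply: sumr_ge0 => l _; exact: bary_ge0.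
Qed.

(** Cutting off the corners where a coordinate is at least 3/4 leaves a core,
    and [core] maps it to the whole simplex, the cut near a vertex going to that
    vertex. The value 1/4 makes all weights but one vanish on the cut, since there
    the other coordinates sum to at most 1/4; the weights still have a positive
    sum, 1 - (p + 1)/4 or more, when p is at most 2. *)
Definition core_weight p (t : simplex p) i : R := Num.max 0 (val t 0 i - 4^-1).

Lemma core_weight_ge0 p (t : simplex p) i : 0 <= core_weight t i.
Proof. by rewrite /core_weight le_max lexx. Qed.

Lemma core_weight_sum_gt0 p (t : simplex p) : (p <= 2)%N ->
  0 < \sum_i core_weight t i.
Proof.
move=> p2; apply: (@lt_le_trans _ _ (\sum_i (val t 0 i - 4^-1))).
  rewrite sumrB bary_sum sumr_const card_ord.
  by case: p p2 t => [|[|[|]]] // _ _; lra.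
by apply: ler_sum => i _; rewrite /core_weight le_max lexx orbT.
Qed.

Lemma core_subproof p (p2 : (p <= 2)%N) (t : simplex p) :
  (\row_i (core_weight t i / \sum_j core_weight t j)) \in simplex p.
Proof.
have W := core_weight_sum_gt0 t p2.
rewrite inE; split=> [i|]; first by rewrite mxE divr_ge0 ?core_weight_ge0 // ltW.
under eq_bigr do rewrite mxE.
by rewrite -mulr_suml divff // gt_eqF.
Qed.

Definition core p (p2 : (p <= 2)%N) (t : simplex p) : simplex p :=
  exist (fun x => x \in simplex p) _ (core_subproof p2 t).

Lemma coreE p p2 (t : simplex p) i :
  val (core p2 t) 0 i = core_weight t i / \sum_j core_weight t j.
Proof. by rewrite /= mxE. Qed.

Lemma core_weight_continuous p i : continuous (fun t : simplex p => core_weight t i).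
Proof.
apply: continuous_max0 => t.
apply: (@continuousB R R _ (fun t : simplex p => val t 0 i) (fun=> 4^-1) t).
  exact: bary_continuous.
exact: cst_continuous.
Qed.

Lemma core_continuous p (p2 : (p <= 2)%N) : continuous (core p2).
Proof.
apply: simplex_continuous => j.
rewrite (_ : (fun _ => _) = fun t => core_weight t j / \sum_i core_weight t i);
  last by apply/funext => t; exact: coreE.
have cW : continuous (fun t : simplex p => \sum_i core_weight t i).
  have := @continuous_sum R (simplex p) R _ (fun i t => core_weight t i).
  by apply; exact: core_weight_continuous.
have W_neq0 (t : simplex p) : \sum_i core_weight t i != 0.
  by rewrite gt_eqF // core_weight_sum_gt0.
move=> t; apply: (@continuousM R _ (fun t => core_weight t j)
  (fun t => (\sum_i core_weight t i)^-1) t); first exact: core_weight_continuous.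
exact: (@continuousV R _ (fun t => \sum_i core_weight t i) t (W_neq0 t) (cW t)).
Qed.

Lemma core_corner p p2 (t : simplex p) i : 3 / 4 <= val t 0 i -> core p2 t = vertex i.
Proof.
move=> ti.
have w0 j : j != i -> core_weight t j = 0.
  move=> /(bary_corner t) tj; apply/eqP; rewrite eq_le core_weight_ge0 andbT.
  by rewrite /core_weight ge_max lexx; lra.
have wi : \sum_j core_weight t j = core_weight t i.
  by rewrite (bigD1 i) //= big1 ?addr0 // => j; exact: w0.
have W := core_weight_sum_gt0 t p2.
apply: simplex_eq => j; rewrite coreE vertexE wi; case: eqVneq => [->|/w0 ->].
  by rewrite divff // -wi gt_eqF.
by rewrite mul0r.
Qed.

Lemma core_weight_face p (i : 'I_p.+2) (t : simplex p) j :
  core_weight (face i t) j = if unlift i j is Some l then core_weight t l else 0.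
Proof.
rewrite /core_weight /= mxE; case: unliftP => // _.
by rewrite sub0r maxEle ifF //; apply/negbTE; lra.
Qed.

Lemma core_face p p2 p2' (i : 'I_p.+2) (t : simplex p) :
  core p2' (face i t) = face i (core p2 t).
Proof.
have sE : \sum_j core_weight (face i t) j = \sum_j core_weight t j.
  rewrite (bigD1_ord i) //= core_weight_face unlift_none add0r.
  by apply: eq_bigr => j _; rewrite core_weight_face liftK.
apply: simplex_eq => j; rewrite coreE sE core_weight_face /= mxE.
by case: unliftP => [l _|]; rewrite ?mxE // mul0r.
Qed.

Variable gam : X -> R -> X.
Hypothesis gamC : forall x, continuous (gam x).
Hypothesis gam1 : forall x, gam x 1 = x.

(** A simplex with a path glued to each vertex: the corner at vertex i runs along
    the path gam from the basepoint to that vertex and the core carries the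
    original simplex. The construction moves all vertices to the basepoint and
    commutes with faces, so that it turns relations between 1-simplices into
    relations between loops. *)
Definition whisker_fun p (p2 : (p <= 2)%N) (s : simp p) (t : simplex p) : X :=
  if [pick i | 3 / 4 <= val t 0 i] is Some i
  then gam (s (vertex i)) (4 * (1 - val t 0 i)) else s (core p2 t).

Lemma whisker_corner p p2 (s : simp p) (t : simplex p) i : 3 / 4 <= val t 0 i ->
  whisker_fun p2 s t = gam (s (vertex i)) (4 * (1 - val t 0 i)).
Proof.
rewrite /whisker_fun => ti; case: pickP => [j tj|/(_ i)]; last by rewrite ti.
by case: (eqVneq j i) => [->//|/(bary_corner t) tji]; exfalso; lra.
Qed.

Lemma whisker_core p p2 (s : simp p) (t : simplex p) : (forall i, val t 0 i <= 3 / 4) ->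
  whisker_fun p2 s t = s (core p2 t).
Proof.
rewrite /whisker_fun => t_le; case: pickP => // i ti; rewrite (core_corner _ ti).
have -> : 4 * (1 - val t 0 i) = 1 by have := t_le i; lra.
exact: gam1.
Qed.

(** Corners do not meet, even after enlarging them to coordinate > 1/2; so near
    every point the map is either the core alone or two pieces glued along one
    cut, where both take the value s (vertex i). *)
Lemma whisker_continuous p p2 (s : simp p) : continuous (whisker_fun p2 s).
Proof.
have cs : continuous (s \o core p2).
  move=> t; apply: continuous_comp; first exact: core_continuous.
  exact: cts_fun.
(* the threshold t_i >= 3/4, shifted to the form u <= 1/2 *)
pose G i (t : simplex p) := if 5 / 4 - val t 0 i <= 2^-1
  then gam (s (vertex i)) (4 * (1 - val t 0 i)) else (s \o core p2) t.
have cG i : continuous (G i).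
  have c1 : continuous (fun t : simplex p => 5 / 4 - val t 0 i).
    move=> t; apply: (@continuousB R R _ (fun=> 5 / 4) (fun t : simplex p => val t 0 i) t).
      exact: cst_continuous.
    exact: bary_continuous.
  have := @within_glue R (simplex p) X setT (fun t => 5 / 4 - val t 0 i)
    (fun t => gam (s (vertex i)) (4 * (1 - val t 0 i))) (s \o core p2) closedT c1.
  rewrite /G => g; apply/continuous_subspace_setT/g.
  - apply: continuous_subspaceT => t.
    apply: (@continuous_comp _ _ _ (fun t : simplex p => 4 * (1 - val t 0 i))); last exact: gamC.
    apply: (@continuousM R _ (fun=> 4) (fun t : simplex p => 1 - val t 0 i) t).
      exact: cst_continuous.
    apply: (@continuousB R R _ (fun=> 1) (fun t : simplex p => val t 0 i) t).
      exact: cst_continuous.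
    exact: bary_continuous.
  - exact: continuous_subspaceT.
  - move=> t _ ti /=; rewrite (@core_corner _ _ _ i); last lra.
    by rewrite (_ : 4 * _ = 1) ?gam1 //; lra.
move=> t; have nF : Filter (nbhs t) by exact: nbhs_filter.
have [[i ti]|nt] := pselect (exists i, 2^-1 < val t 0 i).
- have E : {near t, G i =1 whisker_fun p2 s}.
    apply: (@filterS _ (nbhs t) nF _ _ _ (@bary_continuous R p i t _ (lt_nbhsr ti))) => u /= ui.
    rewrite /G; case: ifPn => h; first by rewrite (@whisker_corner _ _ _ _ i) //; lra.
    rewrite whisker_core // => j; case: (eqVneq j i) => [->|/(bary_corner u)]; lra.
  rewrite /continuous_at -(nbhs_singleton E).
  by apply: cvg_trans (cG i t); exact: near_eq_cvg.
- have E : {near t, s \o core p2 =1 whisker_fun p2 s}.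
    have : nbhs t [set u : simplex p | forall j, val u 0 j < 3 / 4].
      apply: (@filter_forall _ _ (fun j (u : simplex p) => val u 0 j < 3 / 4) (nbhs t) nF) => j.
      have tj : val t 0 j < 3 / 4.
        by rewrite ltNge; apply/negP => tj; apply: nt; exists j; lra.
      exact: (@bary_continuous R p j t _ (lt_nbhsl tj)).
    move=> tP; apply: (@filterS _ (nbhs t) nF _ _ _ tP) => u /= uj.
    by rewrite whisker_core // => j; apply/ltW.
  rewrite /continuous_at -(nbhs_singleton E).
  by apply: cvg_trans (cs t); exact: near_eq_cvg.
Qed.

Definition whisker p p2 (s : simp p) : simp p := mkcont (@whisker_continuous p p2 s).

Lemma whisker_face p p2 p2' (s : simp p.+1) i :
  (whisker p2' s \o @face R p i : simp p) = whisker p2 (s \o @face R p i : simp p).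
Proof.
apply/continuousEP => t /=.
have faceE j : face_fun i (val t) 0 (lift i j) = val t 0 j by rewrite mxE liftK.
have [[j tj]|nt] := pselect (exists j, 3 / 4 <= val t 0 j).
  rewrite (whisker_corner _ _ tj) (@whisker_corner _ _ _ _ (lift i j)) /= ?faceE //.
  by rewrite -face_vertex.
have tle j : val t 0 j <= 3 / 4.
  by rewrite leNgt; apply/negP => tj; apply: nt; exists j; exact: ltW.
rewrite !whisker_core //= -?core_face // => j /=.
by rewrite mxE; case: unliftP => [l _|_]; [exact: tle|lra].
Qed.

End Whisker.

(** * Loops carried by 1-simplices *)

Section SimplexLoops.
Variables (R : realType) (X : topologicalType).
Local Notation simplex p := (@stdsimplex R p).
Local Notation simp p := (@singular_simplex R X p).
Local Notation chains p := (@chains R X p).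

Lemma edge_point_subproof (s : R) :
  (\row_i (if i == 0 then 1 - clip s else clip s) : 'rV[R]_2) \in simplex 1.
Proof.
have s01 := clip_itv s.
rewrite inE; split=> [i|]; first by rewrite mxE; case: ifP => _; lra.
by rewrite 2!big_ord_recl big_ord0 !mxE /= addr0 subrK.
Qed.

Definition edge_point s : simplex 1 :=
  exist (fun x => x \in simplex 1) _ (edge_point_subproof s).

Lemma edge_pointE0 s : val (edge_point s) 0 0 = 1 - clip s.
Proof. by rewrite /= mxE. Qed.

Lemma edge_pointE1 s : val (edge_point s) 0 1 = clip s.
Proof. by rewrite /= mxE. Qed.

Lemma forall_ord2 (P : 'I_2 -> Prop) : P 0 -> P 1 -> forall i, P i.
Proof.
move=> P0 P1 [[|[|]] //= i2].
  by rewrite (_ : Ordinal i2 = 0) //; exact: val_inj.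
by rewrite (_ : Ordinal i2 = 1) //; exact: val_inj.
Qed.

Lemma forall_ord3 (P : 'I_3 -> Prop) : P 0 -> P 1 -> P 2 -> forall i, P i.
Proof.
move=> P0 P1 P2 [[|[|[|]]] //= i3].
- by rewrite (_ : Ordinal i3 = 0) //; exact: val_inj.
- by rewrite (_ : Ordinal i3 = 1) //; exact: val_inj.
- by rewrite (_ : Ordinal i3 = 2) //; exact: val_inj.
Qed.

Lemma edge_point_continuous : continuous edge_point.
Proof.
apply: simplex_continuous; apply: forall_ord2.
  rewrite (_ : (fun _ => _) = fun s => 1 - clip s); last by apply/funext => s; exact: edge_pointE0.
  by move=> s; apply: cvgB; [exact: cvg_cst|exact: clip_continuous].
rewrite (_ : (fun _ => _) = @clip R); last by apply/funext => s; exact: edge_pointE1.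
exact: clip_continuous.
Qed.

Lemma edge_pointK (t : simplex 1) : edge_point (val t 0 1) = t.
Proof.
apply: simplex_eq; apply: forall_ord2; rewrite ?edge_pointE0 ?edge_pointE1 clip_id ?bary_le1 //.
by rewrite unit_bary.
Qed.

Lemma edge_point0 : edge_point 0 = vertex R 0.
Proof.
apply: simplex_eq; apply: forall_ord2;
  rewrite ?edge_pointE0 ?edge_pointE1 clip_id ?vertexE //=; lra.
Qed.

Lemma edge_point1 : edge_point 1 = vertex R 1.
Proof.
apply: simplex_eq; apply: forall_ord2;
  rewrite ?edge_pointE0 ?edge_pointE1 clip_id ?vertexE //=; lra.
Qed.

Variable x0 : X.
Implicit Types f g : loop R x0.

Lemma loop_simplex_edge f s : 0 <= s <= 1 -> loop_simplex f (edge_point s) = f s.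
Proof. by move=> s01; rewrite /= /loop_simplex_fun edge_pointE1 clip_id. Qed.

Lemma loop_simplex_vertex f i : loop_simplex f (vertex R i) = x0.
Proof.
by move: i; apply: forall_ord2; rewrite -?edge_point0 -?edge_point1 loop_simplex_edge
  ?loop_0 ?loop_1 //; lra.
Qed.

(** Two edges of a triangle are homotopic to the third because the triangle is
    convex: the homotopy is the straight line in barycentric coordinates between
    the two parametrized paths, pushed forward by tau. *)
Lemma homotopic_triangle (tau : simp 2) (f0 f1 f2 : loop R x0) :
  (tau \o @face R 1 0 : simp 1) = loop_simplex f0 ->
  (tau \o @face R 1 1 : simp 1) = loop_simplex f1 ->
  (tau \o @face R 1 2 : simp 1) = loop_simplex f2 ->
  homotopic (loop_cat f2 f0) f1.
Proof.
move=> e0 e1 e2.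
have E (i : 'I_3) f : (tau \o @face R 1 i : simp 1) = loop_simplex f ->
    forall s, 0 <= s <= 1 -> f s = tau (face i (edge_point s)).
  move=> e s s01; rewrite -(loop_simplex_edge f s01) -e //.
(* p and q are the outer coordinates of the path along the edges 2 and 0 *)
pose p (s : R) : R := Num.max 0 (1 - 2 * s).
pose q (s : R) : R := Num.max 0 (2 * s - 1).
have cp : continuous p.
  apply: continuous_max0 => s.
  by apply: cvgB; [exact: cvg_cst|apply: cvgM; [exact: cvg_cst|exact: cvg_id]].
have cq : continuous q.
  apply: continuous_max0 => s.
  by apply: cvgB; [apply: cvgM; [exact: cvg_cst|exact: cvg_id]|exact: cvg_cst].
(* barycentric coordinates 0 and 2 at time z.2, the target being the edge 1 *)
pose v0 (z : R * R) := (1 - clip z.2) * p (clip z.1) + clip z.2 * (1 - clip z.1).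
pose v2 (z : R * R) := (1 - clip z.2) * q (clip z.1) + clip z.2 * clip z.1.
have c1 : continuous (fun z : R * R => clip z.1).
  by move=> z; apply: continuous_comp; [exact: cvg_fst|exact: clip_continuous].
have c2 : continuous (fun z : R * R => clip z.2).
  by move=> z; apply: continuous_comp; [exact: cvg_snd|exact: clip_continuous].
have c2' : continuous (fun z : R * R => 1 - clip z.2).
  by move=> z; apply: cvgB; [exact: cvg_cst|exact: c2].
have cpq (r : R -> R) : continuous r -> continuous (fun z : R * R => r (clip z.1)).
  move=> cr z; apply: (@continuous_comp _ _ _ (fun z : R * R => clip z.1) r); last exact: cr.
  exact: c1.
have cv0 : continuous v0.
  move=> z; apply: cvgD; apply: cvgM; [exact: c2'|exact: (cpq _ cp)|exact: c2|].
  by apply: cvgB; [exact: cvg_cst|exact: c1].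
have cv2 : continuous v2.
  by move=> z; apply: cvgD; apply: cvgM; [exact: c2'|exact: (cpq _ cq)|exact: c2|exact: c1].
have pq s : 0 <= s <= 1 -> [/\ 0 <= p s, 0 <= q s & p s + q s <= 1].
  by move=> s01; rewrite /p /q !maxEle; split; case: ifPn; try lra; case: ifPn; lra.
have v_in (z : R * R) : (\row_i nth 0 [:: v0 z; 1 - v0 z - v2 z; v2 z] (i : 'I_3)) \in simplex 2.
  have [p0 q0 pq1] := pq _ (clip_itv z.1).
  have /andP[a0 a1] := clip_itv z.1; have /andP[b0 b1] := clip_itv z.2.
  rewrite inE; split.
    apply: forall_ord3; rewrite mxE /= /v0 /v2; try nra.
  rewrite 3!big_ord_recl big_ord0 !mxE /=; lra.
pose h z : simplex 2 := exist (fun x => x \in simplex 2) _ (v_in z).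
have ch : continuous h.
  apply: simplex_continuous; apply: forall_ord3.
  - by rewrite (_ : (fun _ => _) = v0) //; apply/funext => z; rewrite /= mxE.
  - rewrite (_ : (fun _ => _) = (fun z => 1 - v0 z - v2 z)).
      by move=> z; apply: cvgB; [apply: cvgB; [exact: cvg_cst|exact: cv0]|exact: cv2].
    by apply/funext => z; rewrite /= mxE.
  - by rewrite (_ : (fun _ => _) = v2) //; apply/funext => z; rewrite /= mxE.
have clip0 : @clip R 0 = 0 by apply: clip_id; lra.
have clip1 : @clip R 1 = 1 by apply: clip_id; lra.
have h_face (i : 'I_3) z s :
    (forall j, val (h z) 0 j = val (face i (edge_point s)) 0 j) ->
    tau (h z) = tau (face i (edge_point s)).
  by move=> hi; congr (tau _); exact: simplex_eq.
have face0E s j : val (face (0 : 'I_3) (edge_point s)) 0 j = nth 0 [:: 0; 1 - clip s; clip s] j.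
  rewrite /= mxE; case: unliftP => [l ->|->] //=.
  by rewrite mxE; move: l; apply: forall_ord2.
have face1E s j : val (face (1 : 'I_3) (edge_point s)) 0 j = nth 0 [:: 1 - clip s; 0; clip s] j.
  rewrite /= mxE; case: unliftP => [l ->|->] //=.
  by rewrite mxE; move: l; apply: forall_ord2.
have face2E s j : val (face (2 : 'I_3) (edge_point s)) 0 j = nth 0 [:: 1 - clip s; clip s; 0] j.
  rewrite /= mxE; case: unliftP => [l ->|->] //=.
  by rewrite mxE; move: l; apply: forall_ord2.
exists (tau \o h); split.
- apply: continuous_subspaceT => z; apply: continuous_comp; first exact: ch.
  exact: cts_fun.
- move=> s; rewrite /= in_itv /= => s01; split.
    rewrite /cat_fun; case: ifPn => hs.
      rewrite (E 2 _ e2); last lra.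
      apply: h_face => j; rewrite face2E /= mxE clip_id; last lra.
      move: j; apply: forall_ord3; rewrite /= /v0 /v2 /= clip0 clip_id // /p /q !maxEle;
        do ?case: ifPn; lra.
    rewrite (E 0 _ e0); last lra.
    apply: h_face => j; rewrite face0E /= mxE clip_id; last lra.
    move: j; apply: forall_ord3; rewrite /= /v0 /v2 /= clip0 clip_id // /p /q !maxEle;
        do ?case: ifPn; lra.
  rewrite (E 1 _ e1) //.
  apply: h_face => j; rewrite face1E /= mxE clip_id //.
  move: j; apply: forall_ord3; rewrite /= /v0 /v2 /= clip1 clip_id //; lra.
- move=> t; rewrite /= in_itv /= => t01; split.
    rewrite -(loop_0 f1) (E 1 _ e1); last lra.
    apply: h_face => j; rewrite face1E /= mxE clip0.
    move: j; apply: forall_ord3; rewrite /= /v0 /v2 /= clip0 /p /q !maxEle;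
      do ?case: ifPn; lra.
  rewrite -(loop_1 f1) (E 1 _ e1); last lra.
  apply: h_face => j; rewrite face1E /= mxE clip1.
  move: j; apply: forall_ord3; rewrite /= /v0 /v2 /= clip1 /p /q !maxEle;
      do ?case: ifPn; lra.
Qed.

Section WhiskerLoop.
Variable gam : X -> R -> X.
Hypothesis gamC : forall x, continuous (gam x).
Hypothesis gam0 : forall x, gam x 0 = x0.
Hypothesis gam1 : forall x, gam x 1 = x.
Hypothesis gam_base : forall s, gam x0 s = x0.

Let le12 : (1 <= 2)%N. Proof. by []. Qed.
Local Notation whisker1 := (whisker gamC gam1 le12).

Definition whisker_path (s : simp 1) : R -> X := whisker1 s \o edge_point.

Lemma whisker_path_continuous s : continuous (whisker_path s).
Proof.
move=> r; apply: continuous_comp; first exact: edge_point_continuous.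
exact: cts_fun.
Qed.

Lemma whisker_path_start s r : 0 <= r <= 4^-1 ->
  whisker_path s r = gam (s (vertex R 0)) (4 * r).
Proof.
move=> r01; have e0 : val (edge_point r) 0 0 = 1 - r by rewrite edge_pointE0 clip_id //; lra.
rewrite /whisker_path /= (@whisker_corner _ _ _ _ _ _ _ 0) e0; last lra.
by congr (gam _ _); lra.
Qed.

Lemma whisker_path_end s r : 3 / 4 <= r <= 1 ->
  whisker_path s r = gam (s (vertex R 1)) (4 * (1 - r)).
Proof.
move=> r01; have e1 : val (edge_point r) 0 1 = r by rewrite edge_pointE1 clip_id //; lra.
by rewrite /whisker_path /= (@whisker_corner _ _ _ _ _ _ _ 1) e1 //; lra.
Qed.

Lemma whisker_path_mid s r : 4^-1 <= r <= 3 / 4 ->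
  whisker_path s r = s (edge_point (2 * r - 2^-1)).
Proof.
move=> r01; rewrite /whisker_path /= whisker_core //.
  have w0 : core_weight (edge_point r) 0 = 3 / 4 - r.
    by rewrite /core_weight edge_pointE0 clip_id ?maxEle ?ifT; lra.
  have w1 : core_weight (edge_point r) 1 = r - 4^-1.
    by rewrite /core_weight edge_pointE1 clip_id ?maxEle ?ifT; lra.
  congr (s _); apply: simplex_eq => i; rewrite coreE 2!big_ord_recl big_ord0 addr0.
  rewrite (_ : lift _ _ = 1) -?[ord0]/(0 : 'I_2); last exact: val_inj.
  rewrite w0 w1 (_ : _ - r + _ = 2^-1) ?invrK; last lra.
  move: i; apply: forall_ord2; rewrite ?edge_pointE0 ?edge_pointE1 ?w0 ?w1 clip_id; lra.
by apply: forall_ord2; rewrite ?edge_pointE0 ?edge_pointE1 clip_id; lra.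
Qed.

Lemma whisker_loop0 s : whisker_path s 0 = x0.
Proof. by rewrite whisker_path_start ?mulr0 //; lra. Qed.

Lemma whisker_loop1 s : whisker_path s 1 = x0.
Proof. by rewrite whisker_path_end ?subrr ?mulr0 //; lra. Qed.

Definition whisker_loop s : loop R x0 :=
  Loop (continuous_subspaceT (@whisker_path_continuous s)) (whisker_loop0 s) (whisker_loop1 s).

Lemma loop_simplex_whisker s : loop_simplex (whisker_loop s) = whisker1 s.
Proof.
apply/continuousEP => t.
by rewrite /= /loop_simplex_fun /= /whisker_path [in LHS]/comp edge_pointK.
Qed.

(** For a simplex which is already a based loop, the whiskers are constant, and
    the whiskered loop is a reparametrization. *)
Lemma whisker_loop_homotopic f : homotopic (whisker_loop (loop_simplex f)) f.
Proof.
apply: (@homotopic_reparam _ _ _ f (fun s => clip (2 * s - 2^-1)) id).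
- exact: loop_cts.
- move=> s; apply: (@continuous_comp _ _ _ (fun s : R => 2 * s - 2^-1));
    last exact: clip_continuous.
  by apply: cvgB; [apply: cvgM; [exact: cvg_cst|exact: cvg_id]|exact: cvg_cst].
- by move=> s; exact: cvg_id.
- by move=> s _; rewrite /= in_itv /= clip_itv.
- by [].
- move=> s; rewrite /= in_itv /= => s01.
  have [s1|s1] := leP s 4^-1.
    rewrite whisker_path_start ?loop_simplex_vertex ?gam_base; last lra.
    have -> : clip (2 * s - 2^-1) = 0 :> R by rewrite /clip maxEle minEle; do 2?case: ifPn; lra.
    by rewrite loop_0.
  have [s2|s2] := leP s (3 / 4).
    rewrite whisker_path_mid; last lra.
    by rewrite loop_simplex_edge ?clip_id //; lra.
  rewrite whisker_path_end ?loop_simplex_vertex ?gam_base; last lra.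
  have -> : clip (2 * s - 2^-1) = 1 :> R by rewrite /clip maxEle minEle; do 2?case: ifPn; lra.
  by rewrite loop_1.
- by [].
- by rewrite /clip maxEle minEle; do 2?case: ifPn; lra.
- by rewrite /clip maxEle minEle; do 2?case: ifPn; lra.
Qed.

Definition gam_simplex x : simp 1 := seg (@gamC x) 0 1.

(** The whiskered path splits at 1/4 and 3/4 into a whisker, the simplex and the
    other whisker reversed. *)
Lemma whisker_homologous s : homologous << loop_simplex (whisker_loop s) >>
  (<< s >> + (<< gam_simplex (s (vertex R 0)) >> - << gam_simplex (s (vertex R 1)) >>)).
Proof.
have cp := @whisker_path_continuous s.
have segP a b (u : simp 1) :
    (forall r, 0 <= r <= 1 -> whisker_path s (a + (b - a) * r) = u (edge_point r)) ->
    seg cp a b = u.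
  move=> h; apply/continuousEP => t; rewrite -[t in RHS]edge_pointK -h ?bary_le1 //.
  by rewrite segE unit_bary; congr whisker_path; rewrite /GRing.scale /=; ring.
have gamE x a b r : 0 <= r <= 1 -> seg (@gamC x) a b (edge_point r) = gam x ((1 - r) * a + r * b).
  by move=> r01; rewrite segE edge_pointE0 edge_pointE1 clip_id.
have e1 : seg cp 0 4^-1 = gam_simplex (s (vertex R 0)).
  by apply: segP => r r01; rewrite gamE // whisker_path_start; last lra; congr gam; lra.
have e2 : seg cp 4^-1 (3 / 4) = s.
  by apply: segP => r r01; rewrite whisker_path_mid; last lra; congr (s (edge_point _)); lra.
have e3 : seg cp (3 / 4) 1 = seg (@gamC (s (vertex R 1))) 1 0.
  by apply: segP => r r01; rewrite gamE // whisker_path_end; last lra; congr gam; lra.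
have e4 : seg cp 0 1 = loop_simplex (whisker_loop s).
  apply: segP => r r01; rewrite /= /loop_simplex_fun edge_pointE1 clip_id //=.
  by rewrite subr0 mul1r add0r.
have h1 := homologous_seg_cat cp 0 4^-1 (3 / 4).
have h2 := homologous_seg_cat cp 0 (3 / 4) 1.
have h3 := homologous_seg_rev (@gamC (s (vertex R 1))) 0 1.
rewrite e1 e2 in h1; rewrite e3 e4 in h2.
apply: homologous_trans (homologous_sym h2) _.
rewrite addrA [<< s >> + _]addrC.
exact: homologousD (homologous_sym h1) h3.
Qed.

End WhiskerLoop.
End SimplexLoops.

(** * The Hurewicz theorem in degree one *)

Section Hurewicz.
Local Open Scope quotient_scope.
Variables (R : realType) (X : topologicalType) (x0 : X).
Local Notation simplex p := (@stdsimplex R p).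
Local Notation simp p := (@singular_simplex R X p).
Local Notation chains p := (@chains R X p).
Local Notation cycles := (@cycles R X 0).
Local Notation H1 := (H1 R X).
Local Notation G := (pi1 R x0).
Local Notation cls := (\pi_(Quotient.quot (@is_boundary R X 0))).

Lemma homology_eq (z z' : cycles) :
  (cls z == cls z') = `[< homologous (val z) (val z') >].
Proof. by rewrite -Quotient.idealrBE inE /homologous -GRing.valB. Qed.

Lemma homology_eqP (z z' : cycles) :
  homologous (val z) (val z') -> cls z = cls z'.
Proof. by move=> h; apply/eqP; rewrite homology_eq; exact/asboolP. Qed.

Lemma hurewicz_pi (f : loop R x0) : hurewicz (\pi_(pi1 R x0) f) = cls (loop_cycle f).
Proof. by apply: homology_eqP; apply: homotopic_homologous; exact: repr_homotopic. Qed.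

Lemma hurewiczM (a b : G) : hurewicz (a * b)%g = hurewicz a + hurewicz b.
Proof.
elim/quotW: a => f; elim/quotW: b => g.
rewrite [(_ * _)%g]pi1_mulE !hurewicz_pi -raddfD /=.
by apply: homology_eqP; exact: loop_cat_homologous.
Qed.

Hypothesis Xpc : forall x : X, exists p : R -> X, [/\ continuous p, p 0 = x0 & p 1 = x].

(** The whisker at the basepoint is taken constant, so that whiskering fixes
    the class of a based loop. *)
Lemma whiskers_exist : exists gam : X -> R -> X,
  [/\ forall x, continuous (gam x), forall x, gam x 0 = x0,
      forall x, gam x 1 = x & forall s, gam x0 s = x0].
Proof.
have : forall x, exists p : R -> X, [/\ continuous p, p 0 = x0, p 1 = x & x = x0 -> p = cst x0].
  move=> x; have [->|xx0] := pselect (x = x0).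
    by exists (cst x0); split => //; exact: cst_continuous.
  by have [p [cp p0 p1]] := Xpc x; exists p; split.
move=> /choice[gam gamP]; exists gam; split=> [x|x|x|s]; try by have [] := gamP x.
by have [_ _ _ ->] := gamP x0.
Qed.

(** Send a 1-simplex to the value of phi on its whiskered loop. This additive map
    kills boundaries since the three whiskered edges of a 2-simplex bound a
    triangle with all vertices at the basepoint. It is the half of the Hurewicz
    theorem that says that the kernel consists of commutators. *)
Lemma hurewicz_factor (V : zmodType) (phi : G -> V) :
  {morph phi : a b / (a * b)%g >-> a + b} ->
  exists Phi : {additive H1 -> V}, forall a, Phi (hurewicz a) = phi a.
Proof.
move=> phiM; have [gam [gamC gam0 gam1 gamB]] := whiskers_exist.
pose wl := whisker_loop gamC gam0 gam1.
have [Psi PsiU] := malg_lift (fun s : simp 1 => phi (\pi_(pi1 R x0) (wl s))).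
have Psi_bdry b : Psi (bdry b) = 0.
  have tri (tau : simp 2) : Psi (bdry_simplex tau) = 0.
    rewrite /bdry_simplex 3!big_ord_recl big_ord0 addr0 expr0 expr1 sqrrN expr1n.
    rewrite !raddfD /= monalgUN raddfN !PsiU.
    have h : homotopic
        (loop_cat (wl (tau \o @face R 1 2 : simp 1)) (wl (tau \o @face R 1 0 : simp 1)))
        (wl (tau \o @face R 1 1 : simp 1)).
      apply: (@homotopic_triangle _ _ _ (whisker gamC gam1 (isT : (2 <= 2)%N) tau));
        by rewrite loop_simplex_whisker; exact: whisker_face.
    have := congr1 phi (pi1_eq h); rewrite -pi1_mulE phiM => e.
    have l1 : lift ord0 ord0 = 1 :> 'I_3 by exact: val_inj.
    have l2 : lift ord0 (lift ord0 ord0) = 2 :> 'I_3 by exact: val_inj.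
    by rewrite l2 l1 -[ord0]/(0 : 'I_3) -e opprD addrAC addNr sub0r subrr.
  have := @malg_additive_eq _ V (Psi \o @bdry R X 1) \0; apply=> s /=.
  by rewrite bdryU mulr1z tri.
have Psi_hom z z' : cls z = cls z' -> Psi (val z) = Psi (val z').
  move=> /eqP; rewrite homology_eq => /asboolP[b bE].
  by apply/eqP; rewrite -subr_eq0 -raddfB /= -bE Psi_bdry.
pose Phi (h : H1) := Psi (val (repr h)).
have PhiE z : Phi (cls z) = Psi (val z) by apply: Psi_hom; rewrite reprK.
have PhiB : zmod_morphism Phi.
  elim/quotW => z; elim/quotW => z'.
  by rewrite -raddfB !PhiE !raddfB.
exists (additive_of PhiB); elim/quotW => f.
rewrite hurewicz_pi [LHS]PhiE /= PsiU; congr phi; apply: pi1_eq.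
exact: whisker_loop_homotopic.
Qed.

(** Surjectivity, up to additive combinations: replacing every simplex of a cycle
    by its whiskered loop changes the chain by the whiskers of its boundary,
    which is zero. *)
Lemma hurewicz_generates (V : zmodType) (A B : {additive H1 -> V}) :
  (forall a : G, A (hurewicz a) = B (hurewicz a)) -> A =1 B.
Proof.
move=> AB; have [gam [gamC gam0 gam1 gamB]] := whiskers_exist.
pose wl := whisker_loop gamC gam0 gam1.
elim/quotW => z.
suff zE : (cls z : H1) = \sum_(s <- msupp (val z)) hurewicz (\pi_(pi1 R x0) (wl s)) *~ (val z)@_s.
  rewrite zE !raddf_sum; apply: eq_bigr => s _.
  by rewrite !raddfMz AB.
have clsB : zmod_morphism (cls : cycles -> H1) by move=> y y'; exact: raddfB.
transitivity (additive_of clsB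
    (\sum_(s <- msupp (val z)) loop_cycle (wl s) *~ (val z)@_s)); last first.
  rewrite raddf_sum; apply: eq_bigr => s _.
  by rewrite (@raddfMz cycles H1 (additive_of clsB)) hurewicz_pi.
apply: homology_eqP; apply: homologous_sym.
have vB : zmod_morphism (val : cycles -> chains 1) by move=> y y'; exact: GRing.valB.
rewrite -[val (\sum_(s <- _) _)]/(additive_of vB _).
rewrite raddf_sum; under eq_bigr do rewrite (@raddfMz cycles (chains 1) (additive_of vB)) /=.
pose g s := << gam_simplex gamC s >> : chains 1.
(* replace each whiskered loop by its simplex and the difference of two whiskers *)
apply: (@homologous_trans _ _ (\sum_(s <- msupp (val z))
   ((<< s >> + (g (s (vertex R 0)) - g (s (vertex R 1)))) *~ (val z)@_s))).
  apply: homologous_sum => s; apply: homologousMz; exact: whisker_homologous.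
under eq_bigr do rewrite mulrzDl.
rewrite big_split /= [X in _ + X](_ : _ = 0) ?addr0.
  rewrite [val z in X in homologous _ X]monalgE.
  rewrite (_ : \sum_(i <- _) _ = \sum_(k <- msupp (val z)) << (val z)@_k *g k >>).
    exact: homologous_refl.
  by apply: eq_bigr => s _; rewrite [RHS]malg_intU.
have [Gam GamU] := malg_lift (fun s : simp 0 => g (s (vertex R 0))).
(* the whiskers add up to a linear function of the boundary *)
transitivity (- Gam (bdry (val z))); last first.
  by have := valP z; rewrite inE => /eqP ->; rewrite raddf0 oppr0.
rewrite /bdry raddf_sum -sumrN; apply: eq_bigr => s _.
rewrite raddfMz -mulNrz; congr (_ *~ _).
rewrite /bdry_simplex 2!big_ord_recl big_ord0 addr0 expr0 expr1 monalgUN raddfB !GamU /=.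
rewrite !face_vertex opprB.
by congr (g (s _) - g (s _)); congr vertex; exact: val_inj.
Qed.

End Hurewicz.

(** * Path-connectedness of finite CW complexes *)

Section PathConnected.
Variables (R : realType) (X : topologicalType).

(** Paths are defined on the whole line, which a path on the unit interval
    extends to through [clip]. *)
Definition joined (x y : X) := exists p : R -> X, [/\ continuous p, p 0 = x & p 1 = y].

Lemma joined_sym x y : joined x y -> joined y x.
Proof.
move=> [p [cp p0 p1]]; exists (fun s => p (1 - s)); split.
- move=> s; apply: (@continuous_comp _ _ _ (fun s : R => 1 - s)); last exact: cp.
  by apply: cvgB; [exact: cvg_cst|exact: cvg_id].
- by rewrite subr0.
- by rewrite subrr.
Qed.

Lemma joined_trans y x z : joined x y -> joined y z -> joined x z.
Proof.
move=> [p [cp p0 p1]] [q [cq q0 q1]].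
exists (fun s => if s <= 2^-1 then p (2 * s) else q (2 * s - 1)); split.
- apply/continuous_subspace_setT/(@within_glue R R X setT id
    (fun s => p (2 * s)) (fun s => q (2 * s - 1))) => //.
  + by move=> s; exact: cvg_id.
  + by apply: continuous_subspaceT => s; apply: (@continuous_comp _ _ _ (fun s : R => 2 * s));
      [apply: cvgM; [exact: cvg_cst|exact: cvg_id]|exact: cp].
  + apply: continuous_subspaceT => s; apply: (@continuous_comp _ _ _ (fun s : R => 2 * s - 1));
      last exact: cq.
    by apply: cvgB; [apply: cvgM; [exact: cvg_cst|exact: cvg_id]|exact: cvg_cst].
  + by move=> s _ /= ->; rewrite divff // subrr p1 q0.
- by rewrite invr_ge0 ler0n mulr0.
- rewrite ifF; last by apply/negbTE; lra.
  by rewrite (_ : 2 * 1 - 1 = 1) //; lra.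
Qed.

Variable cwX : finite_CW R X.
Local Notation D e := (@disk R (cell_dim e)).
Local Notation cmap e := (@char_map R X cwX e).

Lemma sqnormZ d (a : R) (v : 'rV[R]_d) : sqnorm (a *: v) = a ^+ 2 * sqnorm v.
Proof. by rewrite /sqnorm mulr_sumr; apply: eq_bigr => i _; rewrite mxE exprMn. Qed.

Lemma sqnorm_ge0 d (v : 'rV[R]_d) : 0 <= sqnorm v.
Proof. by apply: sumr_ge0 => i _; exact: sqr_ge0. Qed.

Lemma disk_scale d (a : R) (v : 'rV[R]_d) : 0 <= a <= 1 -> disk v -> disk (a *: v).
Proof.
rewrite /disk /= sqnormZ => a01 v1; have v0 := sqnorm_ge0 v.
nra.
Qed.

Lemma disk_compact d : compact (@disk R d).
Proof.
apply: (@subclosed_compact _ _ [set v : 'rV[R]_d | forall i, `[-1, 1]%classic (v 0 i)]).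
- rewrite (_ : @disk R d = @sqnorm R d @^-1` [set x | x <= 1]) //.
  apply: preimage_closed; last exact: closed_le.
  move=> v _; apply: (@continuous_sum R 'rV[R]_d R d (fun i v => v 0 i ^+ 2)) => i w.
  apply: (@continuous_comp _ _ _ (fun v : 'rV[R]_d => v 0 i) (fun x : R => x ^+ 2)).
    exact: coord_continuous.
  exact: exprn_continuous.
- apply: (@rV_compact R d (fun=> `[-1, 1]%classic)) => _; exact: segment_compact.
- move=> v v1 i; rewrite /= in_itv /=.
  have : v 0 i ^+ 2 <= 1.
    apply: le_trans v1; rewrite /sqnorm (bigD1 i) //= lerDl.
    by apply: sumr_ge0 => j _; exact: sqr_ge0.
  nra.
Qed.

Lemma cell_image_closed (e : cell cwX) : closed (cmap e @` D e).
Proof.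
apply: compact_closed; first exact: CW_hausdorff cwX.
apply: continuous_compact; first exact: CW_continuous.
exact: disk_compact.
Qed.

Lemma cell_joined (e : cell cwX) v : D e v -> joined (cmap e 0) (cmap e v).
Proof.
move=> Dv; exists (fun s => cmap e (clip s *: v)); split.
- apply: (@comp_within_continuous _ _ _ (D e) (fun s => clip s *: v)).
  + by move=> s; apply: cvgZr_tmp; exact: clip_continuous.
  + exact: CW_continuous.
  + by move=> s; apply: disk_scale => //; exact: clip_itv.
- by rewrite clip_id ?scale0r //; lra.
- by rewrite clip_id ?scale1r //; lra.
Qed.

(** A union of path components is a union of closed cells, each of which is
    compact and path-connected, and there are finitely many cells. *)
Lemma joined_closed (P : set X) : (forall x y, joined x y -> P x -> P y) -> closed P.
Proof.
move=> Pj.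
have -> : P = \bigcup_(e in [set e | P (cmap e 0)]) (cmap e @` D e).
  apply/seteqP; split=> [y Py|y [e Pe [v Dv <-]]]; last exact: Pj (cell_joined Dv) Pe.
  have [e [[v v1 vy] _]] := CW_partition cwX y.
  have Dv : D e v by exact: ltW.
  exists e; last by exists v.
  by apply: Pj (joined_sym (cell_joined Dv)) _; rewrite vy.
apply: closed_bigcup => [|e _]; last exact: cell_image_closed.
exact: finite_finset.
Qed.

(** The path component of x0 and its complement are both closed. *)
Lemma CW_joined (x0 x : X) : connected [set: X] -> joined x0 x.
Proof.
move=> Xc.
pose S := [set y | joined x0 y].
have cS : closed S by apply: joined_closed => y z yz xy; exact: joined_trans yz.
have cS' : closed (~` S).
  apply: joined_closed => y z yz xy xz; apply: xy; apply: joined_trans xz _.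
  exact: joined_sym.
have S0 : S x0 by exists (cst x0); split => //; exact: cst_continuous.
suff : S = setT by move=> SE; have : [set: X] x by []; rewrite -SE.
apply: Xc; first by exists x0.
  by exists S; rewrite ?setTI // -[S]setCK; exact: closed_openC.
by exists S; rewrite ?setTI.
Qed.
End PathConnected.

(** * Coordinates on the abelianized fundamental group *)

Lemma additive_row_mx n m (f : {additive 'rV[int]_n -> 'rV[int]_m}) :
  exists A : 'M[int]_(n, m), forall v, f v = v *m A.
Proof.
exists (\matrix_i f (delta_mx 0 i)) => v.
rewrite {1}(row_sum_delta v) raddf_sum mulmx_sum_row; apply: eq_bigr => i _.
by rewrite rowK -[v 0 i]intz !scaler_int raddfMz.
Qed.

Section Coordinates.
Variables (R : realType) (X : topologicalType) (x0 : X) (n : nat).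
Variable psi : {additive H1 R X -> 'rV[int]_n}.
Hypothesis Xpc : forall x : X, joined R x0 x.

Definition h1_coord (a : pi1 R x0) : 'rV[int]_n := psi (hurewicz a).

Lemma h1_coordM a b : h1_coord (a * b)%g = h1_coord a + h1_coord b.
Proof. by rewrite /h1_coord hurewiczM raddfD. Qed.

Hypothesis psi_bij : bijective psi.

(** Together with [h1_coord_generates], the universal property of the
    abelianization among homomorphisms to free abelian groups of finite rank. *)
Lemma h1_coord_factor m (phi : pi1 R x0 -> 'rV[int]_m) :
  {morph phi : a b / (a * b)%g >-> a + b} ->
  exists A : 'M[int]_(n, m), forall a, phi a = h1_coord a *m A.
Proof.
move=> phiM; have [Phi PhiE] := hurewicz_factor Xpc phiM.
have [psi' psiK psi'K] := psi_bij.
have psi'B : zmod_morphism psi'.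
  by move=> u v; apply: (can_inj psiK); rewrite raddfB /= !psi'K.
have PB : zmod_morphism (Phi \o psi') by move=> u v; rewrite /= psi'B raddfB.
have [A AE] := additive_row_mx (additive_of PB).
by exists A => a; rewrite -AE /= /h1_coord psiK PhiE.
Qed.

Lemma h1_coord_generates m (A B : 'M[int]_(n, m)) :
  (forall a, h1_coord a *m A = h1_coord a *m B) -> A = B.
Proof.
move=> AB; have [psi' psiK psi'K] := psi_bij.
have mB (M : 'M[int]_(n, m)) : zmod_morphism (fun h => psi h *m M).
  by move=> u v; rewrite raddfB mulmxBl.
have := @hurewicz_generates _ _ _ Xpc _ (additive_of (mB A)) (additive_of (mB B)) AB.
move=> /= eqAB; apply/row_matrixP => i.
by have := eqAB (psi' (delta_mx 0 i)); rewrite !psi'K -!rowE.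
Qed.
End Coordinates.

(** * Rank and increasing minors *)

(** Minors are indexed by increasing maps, whereas the row extraction of linear
    algebra only provides injective ones. *)
Lemma increasing_rearrangement l s (f : 'I_l -> 'I_s) : injective f ->
  exists (f' : 'I_l -> 'I_s) (sigma : 'I_l -> 'I_l),
    {homo f' : i j / (i < j)%N} /\ f =1 f' \o sigma.
Proof.
move=> f_inj; pose e := sort <=%O (codom f).
have size_e : size e = l by rewrite size_sort size_codom card_ord.
have e_sorted : sorted <%O e by rewrite sort_lt_sorted; exact/injectiveP.
have idx i : (index (f i) e < l)%N.
  by rewrite -[X in (_ < X)%N]size_e index_mem mem_sort codom_f.
exists (fun i => nth (f i) e i), (fun i => Ordinal (idx i)); split; last first.
  by move=> i /=; rewrite (set_nth_default (f i)) ?size_e // nth_index // mem_sort codom_f.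
move=> i j ij; rewrite (set_nth_default (f i)) ?size_e //.
by apply: (sorted_ltn_nth lt_trans _ e_sorted); rewrite ?inE ?size_e.
Qed.

Section RankMinors.
Variable F : fieldType.

Lemma full_rank_rows l s q (M : 'M[F]_(s, q)) : (l <= \rank M)%N ->
  exists2 f : 'I_l -> 'I_s, {homo f : i j / (i < j)%N} & row_free (rowsub f M).
Proof.
move=> lM; pose w := widen_ord lM; pose g := maxrankfun M.
have wg_inj : injective (g \o w).
  by move=> i j /maxrankfun_inj/(congr1 val) /= ij; exact: val_inj.
have free_wg : row_free (rowsub (g \o w) M).
  rewrite rowsub_comp rowsubE /row_free mxrankMfree; last exact: maxrowsub_free.
  rewrite -/(row_free _); apply/row_freeP; exists (rowsub w 1%:M)^T.
  apply/matrixP => i j; rewrite !mxE (bigD1 (w i)) //= !mxE eqxx mul1r big1.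
    rewrite addr0 eq_sym (inj_eq (_ : injective w)) // => a b /(congr1 val) /= ab.
    exact: val_inj.
  by move=> k ki; rewrite !mxE eq_sym (negbTE ki) mul0r.
have [f [sigma [f_incr fE]]] := increasing_rearrangement wg_inj.
exists f => //; rewrite -row_leq_rank.
rewrite -row_leq_rank in free_wg; apply: leq_trans free_wg _.
by rewrite (eq_rowsub _ fE) mxrankS // rowsub_comp_sub.
Qed.

Lemma rank_ge_minor l s q (M : 'M[F]_(s, q)) :
  (l <= \rank M)%N <-> exists2 d, minors l M d & d != 0.
Proof.
split=> [lM|[d [f [g [_ _ ->]]] d0]].
  have [f f_incr free_f] := full_rank_rows lM.
  have rT : (l <= \rank (rowsub f M)^T)%N by rewrite mxrank_tr row_leq_rank.
  have [g g_incr free_g] := full_rank_rows rT.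
  exists (\det (mxsub f g M)); first by exists f, g.
  by rewrite -det_tr -unitfE -[_ \is a _]/(_ \in unitmx) -row_free_unit mxsubcr trmx_mxsub.
have : row_free (mxsub f g M) by rewrite row_free_unit unitmxE unitfE.
rewrite -row_leq_rank => /leq_trans; apply.
rewrite mxsubrc; apply: leq_trans (mxrankS (rowsub_sub _ _)) _.
by rewrite -mxrank_tr trmx_mxsub -(mxrank_tr M) mxrankS // rowsub_sub.
Qed.

(** The truncated subtraction is right: both sides are false when q <= k. *)
Lemma corank_gt k s q (M : 'M[F]_(s, q)) :
  (\rank M < q - k)%N <-> exists2 N : 'M[F]_(k.+1, q), row_free N & M *m N^T = 0.
Proof.
split=> [rM|[N Nfree MN]].
  have kK : (k.+1 <= \rank (kermx M^T))%N by rewrite mxrank_ker mxrank_tr; lia.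
  have [f _ ffree] := full_rank_rows kK.
  exists (rowsub f (kermx M^T)) => //; apply: trmx_inj.
  by rewrite trmx_mul trmxK trmx0 mul_rowsub_mx mulmx_ker; apply/matrixP => i j; rewrite !mxE.
have NK : (N <= kermx M^T)%MS.
  by apply/sub_kermxP; apply: trmx_inj; rewrite trmx_mul trmxK MN trmx0.
have := mxrankS NK; rewrite mxrank_ker mxrank_tr.
by move: Nfree; rewrite -row_leq_rank; lia.
Qed.
End RankMinors.

(** * Evaluation of Laurent polynomials *)

Section LaurentEvaluation.
Variables (n : nat) (K : fieldType) (t : 'rV[K]_n).

Definition monomial_at (k : 'rV[int]_n) : K := \prod_(i < n) t 0 i ^ k 0 i.

Hypothesis t_neq0 : forall i, t 0 i != 0.

Lemma monomial_at0 : monomial_at 0 = 1.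
Proof. by rewrite /monomial_at big1 // => i _; rewrite mxE. Qed.

Lemma monomial_atD k m : monomial_at (k + m) = monomial_at k * monomial_at m.
Proof. by rewrite /monomial_at -big_split; apply: eq_bigr => i _; rewrite mxE expfzDr. Qed.

Variables (A : comNzRingType) (f : {rmorphism A -> K}).

(** Coefficients are sent to K by f at the same time as t is substituted, so
    that integral Laurent polynomials are evaluated directly at complex points. *)
Definition eval_at : laurent n A -> K := malg_ext (fun k a => f a * monomial_at k).

Let monoB k : zmod_morphism (fun a => f a * monomial_at k).
Proof. by move=> a b; rewrite rmorphB mulrBl. Qed.

Lemma eval_at_is_zmod_morphism : zmod_morphism eval_at.
Proof. exact: malg_ext_is_zmod_morphism monoB. Qed.

HB.instance Definition _ :=
  GRing.isZmodMorphism.Build (laurent n A) K eval_at eval_at_is_zmod_morphism.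

Lemma eval_atU k a : eval_at << a *g k >> = f a * monomial_at k.
Proof. exact: malg_extU. Qed.

Lemma eval_at_is_monoid_morphism : monoid_morphism eval_at.
Proof.
split; first by rewrite [LHS]eval_atU rmorph1 mul1r monomial_at0.
move=> g h.
rewrite [g * h]/(lmul g h) /lmul raddf_sum [in RHS]/eval_at /malg_ext mulr_suml.
apply: eq_bigr => k _; rewrite raddf_sum mulr_sumr; apply: eq_bigr => m _.
transitivity (f (g@_k * h@_m) * monomial_at (k + m)); first exact: eval_atU.
by rewrite rmorphM monomial_atD mulrACA.
Qed.

HB.instance Definition _ :=
  GRing.isMonoidMorphism.Build (laurent n A) K eval_at eval_at_is_monoid_morphism.

End LaurentEvaluation.

Lemma laurent_evalE n (K : fieldType) (t : 'rV[K]_n) (g : laurent n K) :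
  laurent_eval t g = eval_at t idfun g.
Proof. by []. Qed.

Lemma eval_map_laurent n (K : fieldType) (t : 'rV[K]_n) (A : comNzRingType)
    (f : {rmorphism A -> K}) (g : laurent n A) :
  laurent_eval t (map_laurent f g) = eval_at t f g.
Proof.
rewrite laurent_evalE /map_laurent raddf_sum; apply: eq_bigr => k _.
exact: eval_atU.
Qed.

(** * Fox calculus and crossed homomorphisms *)

Section FoxDerivation.
Variables (q : nat) (K : fieldType) (rho : word q -> K).
Hypothesis rho_nil : rho [::] = 1.
Hypothesis rho_cons : forall a w, rho (a :: w) = rho [:: a] * rho w.
Variable ev : {additive {malg int[word q]} -> K}.
Hypothesis evU : forall w, ev << w >> = rho w.

Lemma ev_fox_lmul a g : ev (fox_lmul a g) = rho [:: a] * ev g.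
Proof.
have evUz c w : ev << c *g w >> = rho w *~ c by rewrite malg_intU raddfMz evU.
rewrite [in RHS](monalgE g) /fox_lmul !raddf_sum mulr_sumr; apply: eq_bigr => w _.
by rewrite !evUz rho_cons mulrzAr.
Qed.

(** Fox's fundamental formula makes this the value on w of the crossed
    homomorphism which takes the values v on the generators. *)
Definition fox_pairing (v : 'I_q -> K) (w : word q) : K := \sum_j ev (fox j w) * v j.

Lemma fox_pairing_nil v : fox_pairing v [::] = 0.
Proof. by rewrite /fox_pairing big1 // => j _; rewrite /= raddf0 mul0r. Qed.

Lemma fox_pairing_cons v i b w : fox_pairing v ((i, b) :: w) =
  (if b then v i else - (rho [:: (i, false)] * v i)) + rho [:: (i, b)] * fox_pairing v w.
Proof.
rewrite /fox_pairing mulr_sumr.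
under eq_bigr do rewrite /= raddfD /= mulrDl ev_fox_lmul -mulrA.
rewrite big_split /=; congr (_ + _); rewrite (bigD1 i) //= eqxx big1 ?addr0.
  by case: b; rewrite ?raddfN /= evU ?rho_nil ?mul1r ?mulNr.
by move=> j ji; rewrite eq_sym (negbTE ji) raddf0 mul0r.
Qed.

Lemma fox_pairing_cat v u w :
  fox_pairing v (u ++ w) = fox_pairing v u + rho u * fox_pairing v w.
Proof.
elim: u => [|[i b] u IH]; first by rewrite fox_pairing_nil rho_nil mul1r add0r.
by rewrite cat_cons !fox_pairing_cons IH (rho_cons (i, b) u) mulrDr mulrA addrA.
Qed.

End FoxDerivation.

Lemma eval_word_cat (G : groupType) q (x : 'I_q -> G) u w :
  eval_word x (u ++ w) = (eval_word x u * eval_word x w)%g.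
Proof. by elim: u => [|a u IH] /=; rewrite ?mul1g // IH mulgA. Qed.

Definition inv_word q (w : word q) : word q := rev [seq (a.1, ~~ a.2) | a <- w].

Lemma eval_inv_word (G : groupType) q (x : 'I_q -> G) w :
  eval_word x (inv_word w) = (eval_word x w)^-1%g.
Proof.
elim: w => [|[i b] w IH]; first by rewrite /= invg1.
rewrite /inv_word /= rev_cons -cats1 eval_word_cat -/(inv_word w) IH /= mulg1 invgM.
by case: b; rewrite /= ?invgK.
Qed.

(** Crossed homomorphisms from G to K, on which G acts through chi; they are the
    group Z^1(G; K_chi) of 1-cocycles. *)
Definition crossed_hom (G : groupType) (K : fieldType) (chi d : G -> K) :=
  forall g h, d (g * h)%g = d g + chi g * d h.

Section CrossedHoms.
Variables (G : groupType) (K : fieldType) (chi : G -> K).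
Hypothesis chi1 : chi 1%g = 1.
Hypothesis chiM : forall g h, chi (g * h)%g = chi g * chi h.
Variable P : presentation G.
Local Notation x := (@gens G P).
Variable ev : {additive {malg int[word (ngens P)]} -> K}.
Hypothesis evU : forall w, ev << w >> = chi (eval_word x w).

Let rho w := chi (eval_word x w).
Let rho_nil : rho [::] = 1. Proof. exact: chi1. Qed.
Let rho_cons a w : rho (a :: w) = rho [:: a] * rho w.
Proof. by rewrite /rho /= mulg1 chiM. Qed.

Local Notation pairing := (fox_pairing ev).

Lemma crossed_hom1 (d : G -> K) : crossed_hom chi d -> d 1%g = 0.
Proof.
move=> dM; have := dM 1%g 1%g; rewrite mulg1 chi1 mul1r.
by move/eqP; rewrite -subr_eq0 opprD addNKr oppr_eq0 => /eqP.
Qed.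

Lemma crossed_hom_fox (d : G -> K) w : crossed_hom chi d ->
  d (eval_word x w) = pairing (fun j => d (x j)) w.
Proof.
move=> dM; have d1 := crossed_hom1 dM.
elim: w => [|[i b] w IH]; first by rewrite fox_pairing_nil.
rewrite (fox_pairing_cons rho_nil rho_cons evU) /= dM IH /rho.
case: b => /=; rewrite !mulg1 //; congr (_ + _); apply/eqP.
by rewrite -addr_eq0 -dM mulVg d1.
Qed.

Lemma eval_rels i : eval_word x (rels i) = 1%g.
Proof.
apply/rels_define; have := rel_eq_rel (@rels G P) [::] [::] i.
by rewrite /= cats0 => /rel_eq_sym.
Qed.

(** Inserting x x^-1 is harmless for any v. Inserting a relator is harmless when v
    is orthogonal to its derivatives, because the relator itself acts trivially. *)
Lemma rel_eq_pairing v u w : (forall i, pairing v (rels i) = 0) ->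
  rel_eq (@rels G P) u w -> pairing v u = pairing v w.
Proof.
move=> vr; elim=> {u w} [//|u w _ -> //|u v' w _ -> _ -> //|u w i b|u w i].
- rewrite !(fox_pairing_cat rho_nil rho_cons evU); congr (_ + _ * _).
  have rr : rho [:: (i, b); (i, ~~ b)] = 1.
    by rewrite /rho /= mulg1; case: b; rewrite /= ?mulgV ?mulVg.
  rewrite -/(rho _) rr mul1r !(fox_pairing_cons rho_nil rho_cons evU) fox_pairing_nil mulr0 addr0.
  have rb : rho [:: (i, b)] * rho [:: (i, ~~ b)] = 1 by rewrite -rho_cons.
  move: rb; case: b {rr} => /= rb; rewrite ?mulrN ?mulrA ?rb ?mul1r ?subrr ?add0r //.
  by rewrite addNr add0r.
- rewrite !(fox_pairing_cat rho_nil rho_cons evU) vr add0r.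
  by rewrite /rho eval_rels chi1 mul1r.
Qed.

(** The presentation only tells which words are trivial, so equal values are
    compared after multiplying both words by the same inverse word. *)
Lemma pairing_eval v u w : (forall i, pairing v (rels i) = 0) ->
  eval_word x u = eval_word x w -> pairing v u = pairing v w.
Proof.
move=> vr uw.
have trivial y : eval_word x y = eval_word x w -> pairing v (y ++ inv_word w) = 0.
  move=> yw; rewrite -(fox_pairing_nil ev v); apply: rel_eq_pairing => //.
  by apply/rels_define; rewrite eval_word_cat eval_inv_word yw mulgV.
have := trivial _ uw; rewrite -(trivial _ erefl) !(fox_pairing_cat rho_nil rho_cons evU).
by rewrite /rho uw => /addIr.
Qed.

Lemma fox_crossed_hom v : (forall i, pairing v (rels i) = 0) ->
  exists2 d : G -> K, crossed_hom chi d & forall w, d (eval_word x w) = pairing v w.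
Proof.
move=> vr; have [wd wdE] := choice (@gens_generate G P).
exists (pairing v \o wd) => [g h|w] /=; last by apply: pairing_eval => //; rewrite wdE.
have -> : chi g = rho (wd g) by rewrite /rho wdE.
  rewrite -(fox_pairing_cat rho_nil rho_cons evU).
by apply: pairing_eval => //; rewrite eval_word_cat !wdE.
Qed.

(** The space of crossed homomorphisms has dimension greater than k. *)
Definition many_crossed_homs (k : nat) := exists d : 'I_k.+1 -> G -> K,
  (forall i, crossed_hom chi (d i)) /\
  (forall c : 'I_k.+1 -> K, (forall g, \sum_i c i * d i g = 0) -> forall i, c i = 0).

(** A vector in the kernel of the evaluated Jacobian is the same thing as a crossed
    homomorphism, by its values on the generators. This is
    the step which eliminates the presentation. *)
Lemma fox_corank k :
  (\rank (\matrix_(i < nrels P, j < ngens P) ev (fox j (rels i))) < ngens P - k)%N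
  <-> many_crossed_homs k.
Proof.
set M := \matrix_(_, _) _.
have MNE (N : 'M[K]_(k.+1, ngens P)) l i : (M *m N^T) l i = pairing (N i) (rels l).
  by rewrite mxE; apply: eq_bigr => j _; rewrite !mxE.
rewrite corank_gt; split=> [[N Nfree MN]|[d [dX dfree]]].
  have Nr i l : pairing (N i) (rels l) = 0 by rewrite -MNE MN mxE.
  have /choice[d dP] : forall i, exists d : G -> K, crossed_hom chi d /\
      forall w, d (eval_word x w) = pairing (N i) w.
    by move=> i; have [d dX dE] := fox_crossed_hom (Nr i); exists d.
  exists d; split=> [i|c c0 i]; first by have [] := dP i.
  have dN i' j : d i' (x j) = N i' j.
    have [_ /(_ [:: (j, true)])] := dP i'.
    rewrite (fox_pairing_cons rho_nil rho_cons evU) fox_pairing_nil mulr0 addr0 /= => <-.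
    by rewrite mulg1.
  have : (\row_i c i) *m N = 0.
    apply/rowP => j; rewrite !mxE -[RHS](c0 (x j)); apply: eq_bigr => i' _.
    by rewrite mxE dN.
  rewrite -(mul0mx _ N) => /(row_free_inj Nfree)/rowP/(_ i).
  by rewrite !mxE.
pose N := \matrix_(i < k.+1, j < ngens P) d i (x j).
have pN i w : pairing (N i) w = d i (eval_word x w).
  rewrite crossed_hom_fox //; apply: eq_bigr => j _; by rewrite mxE.
exists N; last by apply/matrixP => l i; rewrite MNE pN eval_rels crossed_hom1 ?mxE.
apply: inj_row_free => v vN; apply/rowP => i; rewrite mxE.
apply: (dfree (v 0)) => g; have [w <-] := gens_generate P g.
under eq_bigr do rewrite -pN /fox_pairing mulr_sumr.
rewrite exchange_big big1 //= => j _.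
under eq_bigr do rewrite mulrCA.
rewrite -mulr_sumr (_ : \sum_i _ = (v *m N) 0 j); first by rewrite vN mxE mulr0.
by rewrite mxE; apply: eq_bigr => i' _; rewrite !mxE.
Qed.
End CrossedHoms.

(** * Characteristic varieties as jump loci of crossed homomorphisms *)

Lemma many_crossed_homs_morph (G H : groupType) (K : fieldType) (chi : G -> K)
    (chi' : H -> K) (f : H -> G) k : bijective f -> {morph f : a b / (a * b)%g} ->
  (forall h, chi' h = chi (f h)) ->
  many_crossed_homs chi k -> many_crossed_homs chi' k.
Proof.
move=> [f' fK f'K] fM chiE [d [dX dfree]].
exists (fun i => d i \o f); split=> [i g h|c c0].
  by rewrite /= fM dX chiE.
by apply: dfree => g; rewrite -[RHS](c0 (f' g)); apply: eq_bigr => i _; rewrite /= f'K.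
Qed.

Lemma minors_map (A B : comNzRingType) (f : {rmorphism A -> B}) s q l
    (M : 'M[A]_(s, q)) : minors l (map_mx f M) = f @` minors l M.
Proof.
apply/seteqP; split=> [_ [u [v [uP vP ->]]]|_ [_ [u [v [uP vP ->]]] <-]].
  by exists (\det (mxsub u v M)); [exists u, v|rewrite -map_mxsub det_map_mx].
by exists u, v; split=> //; rewrite -map_mxsub det_map_mx.
Qed.

Lemma gen_ideal_sub (A : comNzRingType) (S : set A) : S `<=` gen_ideal S.
Proof. by move=> a Sa; exists 1%N, (fun=> 1), (fun=> a); rewrite big_ord1 mul1r. Qed.

Section CharVariety.
Variables (R : realType) (X : topologicalType) (x0 : X) (n : nat).
Variable psi : {additive H1 R X -> 'rV[int]_n}.
Variable P : presentation (pi1 R x0).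
Local Notation C := R[i].
Variable t : 'rV[C]_n.

Definition monodromy (g : pi1 R x0) : C := monomial_at t (psi (hurewicz g)).

Hypothesis t_torus : torus t.

Lemma char_variety_minors k : char_variety psi P k t <->
  forall x, minors (ngens P - k) (alexander_matrix psi P) x -> eval_at t intr x = 0.
Proof.
split=> [[_ tV] x xM|xM].
  rewrite -eval_map_laurent; apply: tV; exists 0%N; rewrite expr1.
  by apply: gen_ideal_sub; exists x => //; exact: gen_ideal_sub.
split=> // g [l [m [a [b [bJ gE]]]]].
have /eqP : laurent_eval t (g ^+ l.+1) = 0.
  rewrite gE laurent_evalE rmorph_sum big1 // => i _; rewrite rmorphM.
  have [y [m' [a' [b' [b'M ->]]]] <-] := bJ i.
  rewrite [X in _ * X](_ : _ = 0) ?mulr0 //.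
  apply: etrans (eval_map_laurent t intr _) _; rewrite rmorph_sum big1 // => i' _.
  by rewrite rmorphM [X in _ * X](xM _ (b'M i')) mulr0.
by rewrite !laurent_evalE rmorphXn expf_eq0 => /andP[_ /eqP].
Qed.

(** A point of the torus is a character of the fundamental group, and membership
    in V_k depends on that character alone. *)
Lemma char_variety_crossed k :
  char_variety psi P k t <-> many_crossed_homs monodromy k.
Proof.
have monoB (w : word (ngens P)) : zmod_morphism (fun a : int =>
    << a *g psi (hurewicz (eval_word (@gens _ P) w)) >> : laurent n int).
  by move=> a b; rewrite monalgUB.
pose ab : {additive _ -> laurent n int} := additive_of (malg_ext_is_zmod_morphism monoB).
have evB : zmod_morphism (eval_at t (intr : {rmorphism int -> C}) \o ab).
  by move=> a b; rewrite /comp (raddfB ab); exact: raddfB.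
have evU w : additive_of evB << w >> = monodromy (eval_word (@gens _ P) w).
  by rewrite /= malg_extU // [LHS]eval_atU mul1r.
have chi1 : monodromy 1%g = 1.
  rewrite /monodromy (_ : hurewicz _ = 0) ?raddf0 ?monomial_at0 //.
  by apply: (addrI (hurewicz (1%g : pi1 R x0))); rewrite -hurewiczM mulg1 addr0.
have chiM g h : monodromy (g * h)%g = monodromy g * monodromy h.
  by rewrite /monodromy hurewiczM raddfD monomial_atD.
rewrite -(fox_corank chi1 chiM evU) char_variety_minors.
rewrite (_ : \matrix_(_, _) _ = map_mx (eval_at t intr) (alexander_matrix psi P)); last first.
  by apply/matrixP => i j; rewrite !mxE.
rewrite ltnNge; split=> [xM|].
  apply/negP => /rank_ge_minor[d]; rewrite minors_map => -[x /xM ex <-] /negP; apply.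
  exact/eqP/ex.
move=> /negP rM x xM; apply/eqP/negP => /negP x0'; apply: rM; apply/rank_ge_minor.
by exists (eval_at t intr x) => //; rewrite minors_map; exists x.
Qed.
End CharVariety.

(** * Transfer of closed sets between tori *)

Section ZariskiTransfer.
Variables (R : realType) (n m : nat).
Local Notation C := R[i].
Variables (al : 'rV[C]_n -> 'rV[C]_m) (be : 'rV[C]_m -> 'rV[C]_n).
Hypothesis alK : forall t, torus t -> be (al t) = t.
Hypothesis beK : forall u, torus u -> al (be u) = u.
Hypothesis al_closed : forall Z : set 'rV[C]_n, zariski_closed Z -> zariski_closed (al @` Z).
Hypothesis be_closed : forall Z : set 'rV[C]_m, zariski_closed Z -> zariski_closed (be @` Z).

Lemma closed_torus k (Z : set 'rV[C]_k) : zariski_closed Z -> forall t, Z t -> torus t.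
Proof. by move=> [S ->] t []. Qed.

Lemma transferK (Z : set 'rV[C]_n) : (forall t, Z t -> torus t) -> be @` (al @` Z) = Z.
Proof.
move=> ZT; apply/seteqP; split=> [_ [_ [t Zt <-] <-]|t Zt].
  by rewrite alK //; exact: ZT.
by exists (al t); [exists t|rewrite alK //; exact: ZT].
Qed.

Lemma transfer_irreducible (Z : set 'rV[C]_n) :
  irreducible_closed Z -> irreducible_closed (al @` Z).
Proof.
move=> [Zc [[z Zz] Zirr]]; split; first exact: al_closed.
split=> [|Z1 Z2 Z1c Z2c ZZ]; first by exists (al z), z.
have ZT := closed_torus Zc.
have /Zirr : Z `<=` be @` Z1 `|` be @` Z2.
  move=> t Zt; have : (Z1 `|` Z2) (al t) by apply: ZZ; exists t.
  by case=> ?; [left|right]; exists (al t) => //; rewrite alK //; exact: ZT.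
case=> [||h|h]; [exact: be_closed|exact: be_closed|left|right];
  move=> _ [t /[dup] Zt /h[u Zu <-] <-]; rewrite beK //;
  [exact: closed_torus Z1c _ Zu|exact: closed_torus Z2c _ Zu].
Qed.

Lemma transfer_proper (Z Z' : set 'rV[C]_n) : (forall t, Z' t -> torus t) ->
  (forall t, Z t -> torus t) -> Z `<` Z' -> al @` Z `<` al @` Z'.
Proof.
move=> Z'T ZT [ZZ' nZ]; split; first exact: image_subset.
move=> h; apply: nZ => t Z't.
have [s Zs alst] : (al @` Z) (al t) by apply: h; exists t.
by rewrite -(alK (Z'T _ Z't)) -alst alK //; exact: ZT.
Qed.

Lemma transfer_codim_chain (Z : set 'rV[C]_n) l :
  codim_chain Z l -> codim_chain (al @` Z) l.
Proof.
move=> [F [F0 Firr Flt]]; exists (fun i => al @` F i); split=> [|i il|i il].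
- by rewrite F0.
- exact/transfer_irreducible/Firr.
- apply: transfer_proper; last exact: Flt.
    by apply: closed_torus; have [] := Firr i.+1 il.
  by apply: closed_torus; have [] := Firr i (ltnW il).
Qed.
End ZariskiTransfer.

Section ComponentTransfer.
Variables (R : realType) (n m : nat).
Local Notation C := R[i].
Variables (al : 'rV[C]_n -> 'rV[C]_m) (be : 'rV[C]_m -> 'rV[C]_n).
Hypothesis alT : forall t, torus t -> torus (al t).
Hypothesis beT : forall u, torus u -> torus (be u).
Hypothesis alK : forall t, torus t -> be (al t) = t.
Hypothesis beK : forall u, torus u -> al (be u) = u.
Hypothesis al_closed : forall Z : set 'rV[C]_n, zariski_closed Z -> zariski_closed (al @` Z).
Hypothesis be_closed : forall Z : set 'rV[C]_m, zariski_closed Z -> zariski_closed (be @` Z).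

Lemma transfer_codim (Z : set 'rV[C]_n) : zariski_closed Z -> codim (al @` Z) = codim Z.
Proof.
move=> Zc; rewrite /codim; congr ereal_sup; congr image.
apply/seteqP; split=> l; last exact: (transfer_codim_chain alK beK al_closed be_closed).
move=> /(transfer_codim_chain beK alK be_closed al_closed).
by rewrite (transferK alK) //; exact: closed_torus.
Qed.
Variables (V : set 'rV[C]_n) (W : set 'rV[C]_m).
Hypothesis VW : forall t, torus t -> V t <-> W (al t).

Lemma transfer_component (Z : set 'rV[C]_n) :
  irreducible_components V Z -> irreducible_components W (al @` Z).
Proof.
move=> [Zirr ZV Zmax]; have ZT := closed_torus Zirr.1; split.
- exact: (transfer_irreducible alK beK al_closed be_closed).
- by move=> _ [t Zt <-]; apply/VW; [exact: ZT|exact: ZV].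
- move=> Z' Z'irr ZZ' Z'W; have Z'T := closed_torus Z'irr.1.
  rewrite -(Zmax (be @` Z')) ?(transferK beK) //.
  + exact: (transfer_irreducible beK alK be_closed al_closed).
  + by move=> t Zt; exists (al t); [apply: ZZ'; exists t|exact/alK/ZT].
  + move=> _ [u Z'u <-]; apply/VW; first exact/beT/Z'T.
    by rewrite beK; [exact: Z'W|exact: Z'T].
Qed.
End ComponentTransfer.

Section TransferLists.
Variables (R : realType) (n m : nat).
Local Notation C := R[i].
Variables (al : 'rV[C]_n -> 'rV[C]_m) (be : 'rV[C]_m -> 'rV[C]_n).
Hypothesis alT : forall t, torus t -> torus (al t).
Hypothesis beT : forall u, torus u -> torus (be u).
Hypothesis alK : forall t, torus t -> be (al t) = t.
Hypothesis beK : forall u, torus u -> al (be u) = u.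
Hypothesis al_closed : forall Z : set 'rV[C]_n, zariski_closed Z -> zariski_closed (al @` Z).
Hypothesis be_closed : forall Z : set 'rV[C]_m, zariski_closed Z -> zariski_closed (be @` Z).

Variables (V : set 'rV[C]_n) (W : set 'rV[C]_m).
Hypothesis VW : forall t, torus t -> V t <-> W (al t).

(** Q and Q' are a marking of closed sets preserved by the two maps: all of them,
    or those which pass through the point 1. *)
Lemma transfer_same_list (Q : set (set 'rV[C]_n)) (Q' : set (set 'rV[C]_m)) :
  (forall Z, Q Z -> Q' (al @` Z)) -> (forall Z, Q' Z -> Q (be @` Z)) ->
  same_list (irreducible_components V `&` Q) (@codim R n)
            (irreducible_components W `&` Q') (@codim R m).
Proof.
move=> QQ' Q'Q; have WV u : torus u -> W u <-> V (be u).
  by move=> uT; rewrite (VW (beT uT)) beK.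
exists (fun Z => al @` Z); split; last first.
  by move=> Z [[[Zc _] _ _] _]; exact: (transfer_codim alK beK al_closed be_closed).
split.
- move=> Z [Zcomp QZ]; split; last exact: QQ'.
  exact: (transfer_component beT alK beK al_closed be_closed VW).
- move=> Z Z'; rewrite !inE => -[[[Zc _] _ _] _] [[[Z'c _] _ _] _] ZZ'.
  by rewrite -(transferK alK (closed_torus Zc)) ZZ' (transferK alK (closed_torus Z'c)).
- move=> Z [Zcomp Q'Z]; exists (be @` Z); last first.
    by case: Zcomp => -[Zc _] _ _; exact: (transferK beK (closed_torus Zc)).
  split; last exact: Q'Q.
  exact: (transfer_component alT beK alK be_closed al_closed WV).
Qed.
End TransferLists.

(** * Monomial maps *)

Section MonomialMaps.
Variables (R : realType).
Local Notation C := R[i].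

Definition monomial_map n m (A : 'M[int]_(n, m)) (u : 'rV[C]_m) : 'rV[C]_n :=
  \row_i monomial_at u (row i A).

Lemma monomial_map_torus n m (A : 'M[int]_(n, m)) u : torus u -> torus (monomial_map A u).
Proof.
move=> uT i; rewrite mxE; apply/prodf_neq0 => j _.
exact/expfz_neq0/uT.
Qed.

(** The monomial map attached to A is dual to multiplication by A on exponents. *)
Lemma monomial_at_map n m (A : 'M[int]_(n, m)) u k : torus u ->
  monomial_at (monomial_map A u) k = monomial_at u (k *m A).
Proof.
move=> uT; rewrite /monomial_at.
transitivity (\prod_(i < n) \prod_(j < m) u 0 j ^ (k 0 i * A i j)).
  apply: eq_bigr => i _; rewrite mxE.
  rewrite (big_morph (fun x : C => x ^ k 0 i) (id1 := 1) (op1 := *%R)); last exact: exp1rz.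
    by apply: eq_bigr => j _; rewrite mxE exprz_exp mulrC.
  by move=> x y; rewrite expfzMl.
rewrite exchange_big; apply: eq_bigr => j _; rewrite mxE.
rewrite (big_morph (fun a : int => u 0 j ^ a) (id1 := 1) (op1 := *%R)) //.
by move=> a b; rewrite expfzDr.
Qed.

Lemma monomial_map_comp n m l (A : 'M[int]_(n, m)) (B : 'M[int]_(m, l)) u : torus u ->
  monomial_map A (monomial_map B u) = monomial_map (A *m B) u.
Proof. by move=> uT; apply/rowP => i; rewrite !mxE monomial_at_map // row_mul. Qed.

Lemma monomial_map1 n (u : 'rV[C]_n) : monomial_map 1%:M u = u.
Proof.
apply/rowP => i; rewrite mxE /monomial_at (bigD1 i) //= big1 => [|j ji].
  by rewrite !mxE eqxx mulr1.
by rewrite !mxE eq_sym (negbTE ji).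
Qed.

Lemma monomial_map_one n m (A : 'M[int]_(n, m)) : monomial_map A (const_mx 1) = const_mx 1.
Proof. by apply/rowP => i; rewrite !mxE /monomial_at big1 // => j _; rewrite mxE exp1rz. Qed.

Lemma monomial_map_torsion n m (A : 'M[int]_(n, m)) p u :
  torsion_points p u -> torsion_points p (monomial_map A u).
Proof.
move=> up i; rewrite mxE /monomial_at -prodrXl big1 // => j _.
by rewrite exprnP exprzAC -exprnP up exp1rz.
Qed.

Lemma monomial_map_pullback n m (B : 'M[int]_(m, n)) (g : laurent m C) :
  exists g' : laurent n C, forall t, torus t ->
    laurent_eval t g' = laurent_eval (monomial_map B t) g.
Proof.
exists (\sum_(k <- msupp g) << g@_k *g k *m B >>) => t tT.
rewrite laurent_evalE raddf_sum; apply: eq_bigr => k _.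
by rewrite [LHS]eval_atU -monomial_at_map.
Qed.

Lemma monomial_map_closed n m (A : 'M[int]_(n, m)) (B : 'M[int]_(m, n)) (Z : set 'rV[C]_m) :
  A *m B = 1%:M -> B *m A = 1%:M -> zariski_closed Z -> zariski_closed (monomial_map A @` Z).
Proof.
move=> AB BA [S ->].
(* the image is cut out by the pull-backs of S under the inverse map *)
exists [set g' | exists2 g, S g & forall t, torus t ->
    laurent_eval t g' = laurent_eval (monomial_map B t) g].
apply/seteqP; split=> [_ [u [uT uS] <-]|t [tT tS]].
  split; first exact: monomial_map_torus.
  move=> g' [g Sg ->]; last exact: monomial_map_torus.
  by rewrite monomial_map_comp // BA monomial_map1 uS.
exists (monomial_map B t); last by rewrite monomial_map_comp // AB monomial_map1.
split=> [|g Sg]; first exact: monomial_map_torus.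
have [g' g'E] := monomial_map_pullback B g.
by rewrite -g'E // tS //; exists g.
Qed.
End MonomialMaps.

(** For infinite A and B both sides are 0, as [fset_set] is then empty. *)
Lemma card_fset_set_bij (T U : choiceType) (A : set T) (B : set U) (f : T -> U) (g : U -> T) :
  (forall x, A x -> B (f x)) -> (forall y, B y -> A (g y)) ->
  (forall x, A x -> g (f x) = x) -> (forall y, B y -> f (g y) = y) ->
  #|` fset_set A| = #|` fset_set B|.
Proof.
move=> fB gA fK gK.
have BE : B = f @` A.
  by apply/seteqP; split=> [y By|_ [x Ax <-]]; [exists (g y); [exact: gA|exact: gK]|exact: fB].
have AE : A = g @` B.
  by apply/seteqP; split=> [x Ax|_ [y By <-]]; [exists (f x); [exact: fB|exact: fK]|exact: gA].
have [Afin|Ainf] := pselect (finite_set A).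
  rewrite BE fset_set_image // card_in_imfset //= => x y.
  by rewrite !in_fset_set // !inE => Ax Ay fxy; rewrite -(fK x Ax) fxy fK.
have Binf : ~ finite_set B by move=> Bfin; apply: Ainf; rewrite AE; exact: finite_image.
by rewrite /fset_set; case: pselect => // _; case: pselect.
Qed.

(** * Invariance under isomorphisms of the fundamental group *)

(** The factorization of each coordinate map through the other gives two matrices;
    they are mutually inverse because the coordinates generate. *)
Lemma h1_coord_transfer (R : realType) (X Y : topologicalType) (x0 : X) (y0 : Y) n m
    (psiX : {additive H1 R X -> 'rV[int]_n}) (psiY : {additive H1 R Y -> 'rV[int]_m})
    (f : pi1 R x0 -> pi1 R y0) :
  (forall x, joined R x0 x) -> (forall y, joined R y0 y) ->
  bijective psiX -> bijective psiY -> bijective f -> {morph f : a b / (a * b)%g} ->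
  exists (A : 'M[int]_(n, m)) (B : 'M[int]_(m, n)),
    [/\ A *m B = 1%:M, B *m A = 1%:M
      & forall g, h1_coord psiY (f g) *m B = h1_coord psiX g].
Proof.
move=> Xpc Ypc psiX_bij psiY_bij [f' fK f'K] fM.
have f'M : {morph f' : a b / (a * b)%g}.
  by move=> a b; apply: (can_inj fK); rewrite fM !f'K.
have [A AE] : exists A : 'M[int]_(n, m), forall g, h1_coord psiY (f g) = h1_coord psiX g *m A.
  by apply: (h1_coord_factor Xpc psiX_bij) => a b /=; rewrite fM h1_coordM.
have [B BE] : exists B : 'M[int]_(m, n), forall h, h1_coord psiX (f' h) = h1_coord psiY h *m B.
  by apply: (h1_coord_factor Ypc psiY_bij) => a b /=; rewrite f'M h1_coordM.
exists A, B; split.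
- apply: (h1_coord_generates Xpc psiX_bij) => g.
  by rewrite mulmxA -AE -BE fK mulmx1.
- apply: (h1_coord_generates Ypc psiY_bij) => h.
  by rewrite mulmxA -BE -AE f'K mulmx1.
- by move=> g; rewrite -BE fK.
Qed.

Theorem theorem5p6 (R : realType) (k : nat)
  (X : topologicalType) (cwX : finite_CW R X) (x0 : X) (n : nat)
  (psiX : {additive H1 R X -> 'rV[int]_n}) (PX : presentation (pi1 R x0))
  (Y : topologicalType) (cwY : finite_CW R Y) (y0 : Y) (m : nat)
  (psiY : {additive H1 R Y -> 'rV[int]_m}) (PY : presentation (pi1 R y0)) :
  connected [set: X] -> bijective psiX ->
  connected [set: Y] -> bijective psiY ->
  isomorphic_groups (pi1 R x0) (pi1 R y0) ->
  let VX := char_variety psiX PX k in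
  let VY := char_variety psiY PY k in
  [/\ same_list (irreducible_components VX) (@codim R n)
                (irreducible_components VY) (@codim R m),
      same_list (irreducible_components VX `&` [set Z | Z (const_mx 1)]) (@codim R n)
                (irreducible_components VY `&` [set Z | Z (const_mx 1)]) (@codim R m)
    & forall p, (2 <= p)%N -> Tors psiX PX p k = Tors psiY PY p k].
Proof.
move=> Xc psiX_bij Yc psiY_bij [f [f_bij fM]] VX VY.
have Xpc x : joined R x0 x by exact: CW_joined.
have Ypc y : joined R y0 y by exact: CW_joined.
have [A [B [AB BA LE]]] := h1_coord_transfer Xpc Ypc psiX_bij psiY_bij f_bij fM.
pose al : 'rV[R[i]]_n -> 'rV[R[i]]_m := monomial_map B.
pose be : 'rV[R[i]]_m -> 'rV[R[i]]_n := monomial_map A.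
have alT t : torus t -> torus (al t) by exact: monomial_map_torus.
have beT u : torus u -> torus (be u) by exact: monomial_map_torus.
have alK t : torus t -> be (al t) = t.
  by move=> tT; rewrite /be /al monomial_map_comp // AB monomial_map1.
have beK u : torus u -> al (be u) = u.
  by move=> uT; rewrite /be /al monomial_map_comp // BA monomial_map1.
have al_closed Z : zariski_closed Z -> zariski_closed (al @` Z).
  exact: monomial_map_closed BA AB.
have be_closed Z : zariski_closed Z -> zariski_closed (be @` Z).
  exact: monomial_map_closed AB BA.
have chiE t g : torus t -> monodromy psiY (al t) (f g) = monodromy psiX t g.
  by move=> tT; rewrite /monodromy monomial_at_map // -[psiX _]/(h1_coord psiX g) -LE.
have VW t : torus t -> VX t <-> VY (al t).
  move=> tT; rewrite /VX /VY (char_variety_crossed _ _ tT) (char_variety_crossed _ _ (alT t tT)).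
  have [f' fK f'K] := f_bij.
  split; last by apply: (many_crossed_homs_morph f_bij fM) => g; rewrite chiE.
  apply: (@many_crossed_homs_morph _ _ _ _ _ f') => [|a b|h].
  - by exists f.
  - by apply: (can_inj fK); rewrite fM !f'K.
  - by rewrite -chiE // f'K.
split.
- rewrite -[irreducible_components VX]setIT -[irreducible_components VY]setIT.
  exact: (transfer_same_list alT beT alK beK al_closed be_closed VW).
- apply: (transfer_same_list alT beT alK beK al_closed be_closed VW) => Z Z1;
    by exists (const_mx 1) => //; exact: monomial_map_one.
- move=> p p2.
  have tors_torus l (t : 'rV[R[i]]_l) : torsion_points p t -> torus t.
    move=> tp i; apply/eqP => ti; have := tp i; rewrite ti expr0n.
    by case: p p2 {tp} => // p _ /eqP; rewrite eq_sym oner_eq0.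
  apply: (@card_fset_set_bij _ _ _ _ al be) => t [tp].
  + split; first exact: monomial_map_torsion.
    by apply/VW => //; exact: tors_torus tp.
  + split; first exact: monomial_map_torsion.
    by apply/VW; rewrite ?beK //; [apply: beT|]; exact: tors_torus tp.
  + by move=> _; apply/alK/(tors_torus _ _ tp).
  + by move=> _; apply/beK/(tors_torus _ _ tp).
Qed.
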